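(* Let $n$ be the root node of a probabilistic circuit (PC) and $m$ the root node of a regression circuit (RC), both over the same finite set of Boolean variables $\mathbf{X}$ and both structured decomposable with respect to the same vtree over $\mathbf{X}$; both circuits are smooth and the RC is deterministic. Let $s_n$ and $s_m$ be the numbers of edges of the PC and of the RC, respectively, and let $k\ge 1$ be an integer. Then the $k$-th moment $M_k(g_m,p_n)=\mathbb{E}_{\mathbf{x}\sim p_n(\mathbf{x})}\left[(g_m(\mathbf{x}))^k\right]$ of the RC output function $g_m$ with respect to the distribution $p_n$ encoded by the PC can be computed exactly in time $O(k^2\, s_n\, s_m)$.
   Context: Logical circuits. A logical circuit over Boolean variables $\mathbf{X}$ is a directed acyclic graph whose inner nodes are AND or OR gates and whose leaves are literals ($X$ or $\neg X$). Each node $n$ encodes a logical formula $[n]$; $\mathsf{ch}(n)$ is the set of children (inputs) of $n$; a node depends on the variables appearing in the sub-circuit rooted at it. For an assignment $\mathbf{x}$, $\mathbb{1}_n(\mathbf{x})=1$ if $\mathbf{x}\models[n]$ and $0$ otherwise. Properties. Decomposable: the inputs of every AND gate depend on disjoint sets of variables; AND gates have two inputs, a left child $L$ and a right child $R$, and $\mathbf{x}^L,\mathbf{x}^R$ denote the restrictions of $\mathbf{x}$ to the variables of these children. A vtree over $\mathbf{X}$ is a binary tree whose leaves are the variables in $\mathbf{X}$. Structured decomposable with respect to a vtree: every AND gate corresponds to an inner vtree node $v$ such that its left child depends on variables in the left branch of $v$ and its right child on variables in the right branch of $v$. Smooth: all children of any OR gate depend on the same set of variables. Deterministic: for any input, at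 most one child of every OR gate is satisfied. PC. A PC is a smooth, structured decomposable logical circuit with a parameter $\theta_i$ on each input $i$ of each OR gate (nonnegative, summing to one over the inputs of each OR gate). Node $n$ defines a distribution: $p_n(\mathbf{x})=\mathbb{1}_n(\mathbf{x})$ if $n$ is a leaf; $p_n(\mathbf{x})=p_L(\mathbf{x}^L)\,p_R(\mathbf{x}^R)$ if $n$ is an AND gate; $p_n(\mathbf{x})=\sum_{i\in\mathsf{ch}(n)}\theta_i\,p_i(\mathbf{x})$ if $n$ is an OR gate. (PCs need not be deterministic.) RC. An RC is a smooth, deterministic, structured decomposable logical circuit with a real parameter $\phi_j$ on each input $j$ of each OR gate. Node $m$ has output $g_m(\mathbf{x})=0$ if $m$ is a leaf; $g_m(\mathbf{x})=g_L(\mathbf{x}^L)+g_R(\mathbf{x}^R)$ if $m$ is an AND gate; $g_m(\mathbf{x})=\sum_{j\in\mathsf{ch}(m)}\mathbb{1}_j(\mathbf{x})(\phi_j+g_j(\mathbf{x}))$ if $m$ is an OR gate. Time is measured with arithmetic operations on numbers counted at unit cost. *)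

(* Defs.v *)
From HB Require Import structures.
From mathcomp Require Import all_boot all_order all_algebra.

Set Implicit Arguments.
Unset Strict Implicit.
Unset Printing Implicit Defensive.

Import GRing.Theory Num.Theory.
Local Open Scope ring_scope.

(** * Logical circuits with parameters on the inputs of OR gates *)

(* Variables are the elements of 'I_d; [Lit v b] is the literal satisfied by the
   assignments giving [v] the value [b].  Gates refer to their inputs by node
   number, and each input of an OR gate comes with its parameter. *)
Inductive gate (d : nat) (R : Type) :=
| Lit of 'I_d & bool
| And of nat & nat
| Or of seq (nat * R).

Arguments Lit {d R} _ _.
Arguments And {d R} _ _.
Arguments Or {d R} _.

(* A DAG listed in a topological order, inputs first: node [i] is the [i]-th
   gate and the root is the last one. *)
Definition circuit (d : nat) (R : Type) := seq (gate d R).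

Definition assignment (d : nat) := {ffun 'I_d -> bool}.

Section Circuits.
Context {d : nat} {R : Type}.
Implicit Types (c : circuit d R) (g : gate d R).

Definition or_inputs g : seq (nat * R) := if g is Or ch then ch else [::].

Definition children g : seq nat :=
  match g with
  | Lit _ _ => [::]
  | And l r => [:: l; r]
  | Or ch => map fst ch
  end.

Definition root_node c : nat := (size c).-1.

Definition num_edges c : nat := (\sum_(g <- c) size (children g))%N.

(* [uniq] because the inputs of a gate form a set; OR gates are inner nodes, so
   they have an input.  The last clause makes [root_node c] the only source, i.e.
   every node is reachable from it. *)
Definition wf_circuit c : Prop :=
  [/\ c <> [::],
      forall i g, onth c i = Some g -> all (fun j => (j < i)%N) (children g),
      forall i ch, onth c i = Some (Or ch) -> ch <> [::] /\ uniq (map fst ch)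
    & forall i, (i < root_node c)%N ->
        exists j g, onth c j = Some g /\ i \in children g].

(* [eval x0 step c i] is the value at node [i] of the function on nodes defined
   from the inputs up by [step]; its recursion equation is [evalE] below. *)
Definition eval (T : Type) (x0 : T) (step : gate d R -> (nat -> T) -> T) c :
    nat -> T :=
  nth x0 (foldl (fun vs g => rcons vs (step g (nth x0 vs))) [::] c).

Definition local_step (T : Type) (step : gate d R -> (nat -> T) -> T) : Prop :=
  forall g f f', {in children g, f =1 f'} -> step g f = step g f'.

Lemma evalE (T : Type) (x0 : T) step c i g :
  wf_circuit c -> local_step step -> onth c i = Some g ->
  eval x0 step c i = step g (eval x0 step c).
Proof.
case=> _ wfc _ _ loc; rewrite /eval.
pose F c := foldl (fun vs g => rcons vs (step g (nth x0 vs))) [::] c.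
have Frcons e h : F (rcons e h) = rcons (F e) (step h (nth x0 (F e))).
  by rewrite /F -cats1 foldl_cat.
have szF e : size (F e) = size e.
  by elim/last_ind: e => // e h IH; rewrite Frcons !size_rcons IH.
rewrite -/(F c).
elim/last_ind: c wfc i g => [|c h IH] wfc i g; first by rewrite onth0n.
have wfc' i' g' : onth c i' = Some g' -> all (fun j => (j < i')%N) (children g').
  move=> gi; apply: wfc; rewrite -cats1 onth_cat.
  by rewrite -onthTE gi.
rewrite Frcons => gi.
have ilt : (i < (size c).+1)%N by rewrite -(size_rcons c h) -onthTE gi.
have below : {in children g, nth x0 (F c)
    =1 nth x0 (rcons (F c) (step h (nth x0 (F c))))}.
  move=> j jg; have /allP/(_ _ jg) ji := wfc _ _ gi.
  by rewrite nth_rcons szF (leq_trans ji (ilt : (i <= size c)%N)).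
rewrite -(loc g _ _ below) nth_rcons szF.
move: gi; rewrite -cats1 onth_cat.
case: ltngtP => [ic gi|ci|->]; first exact: IH.
  by move: ilt; rewrite ltnS leqNgt ci.
by rewrite subnn => -[->].
Qed.

Definition scope_step g (s : nat -> {set 'I_d}) : {set 'I_d} :=
  match g with
  | Lit v _ => [set v]
  | And l r => s l :|: s r
  | Or ch => \bigcup_(e <- ch) s e.1
  end.

(* The variables node [i] depends on. *)
Definition scope c : nat -> {set 'I_d} := eval set0 scope_step c.

Definition sat_step (x : assignment d) g (s : nat -> bool) : bool :=
  match g with
  | Lit v b => x v == b
  | And l r => s l && s r
  | Or ch => has (fun e => s e.1) ch
  end.

(* [sat c x i]: [x] satisfies the formula encoded by node [i]. *)
Definition sat c (x : assignment d) : nat -> bool := eval false (sat_step x) c.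

Definition smooth c : Prop :=
  forall i ch, onth c i = Some (Or ch) ->
    {in map fst ch &, forall a b, scope c a = scope c b}.

Definition deterministic c : Prop :=
  forall i ch, onth c i = Some (Or ch) ->
    forall x : assignment d,
      {in map fst ch &, forall a b, sat c x a -> sat c x b -> a = b}.

End Circuits.

(** * Vtrees *)

Inductive vtree (d : nat) :=
| VLeaf of 'I_d
| VNode of vtree d & vtree d.

Fixpoint vleaves d (t : vtree d) : seq 'I_d :=
  match t with
  | VLeaf v => [:: v]
  | VNode l r => vleaves l ++ vleaves r
  end.

Definition wf_vtree d (t : vtree d) : Prop := perm_eq (vleaves t) (enum 'I_d).

(* Some inner node of [t] has [A] in its left branch and [B] in its right one. *)
Fixpoint splits d (t : vtree d) (A B : {set 'I_d}) : bool :=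
  match t with
  | VLeaf _ => false
  | VNode l r =>
      [|| (A \subset vleaves l) && (B \subset vleaves r), splits l A B
        | splits r A B]
  end.

Definition structured d R (t : vtree d) (c : circuit d R) : Prop :=
  forall i l r, onth c i = Some (And l r) -> splits t (scope c l) (scope c r).

Lemma structured_decomposable d R (t : vtree d) (c : circuit d R) :
  wf_vtree t -> structured t c ->
  forall i l r, onth c i = Some (And l r) -> [disjoint scope c l & scope c r].
Proof.
move=> wft st i l r /st; have: uniq (vleaves t).
  by rewrite (perm_uniq wft) enum_uniq.
elim: t {wft st} => [v|tl IHl tr IHr] //=.
rewrite cat_uniq => /and3P[ul /hasPn dis ur].
case/or3P => [/andP[/subsetP sl /subsetP sr]||]; [|exact: IHl|exact: IHr].
rewrite disjoint_subset; apply/subsetP => v /sl vl; apply/negP => /sr/dis.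
by rewrite /= vl.
Qed.

(** * Probabilistic and regression circuits *)

Section Values.
Context {d : nat} {R : realFieldType}.
Implicit Types (c : circuit d R) (x : assignment d).

Definition pc_step x (g : gate d R) (p : nat -> R) : R :=
  match g with
  | Lit v b => (x v == b)%:R
  | And l r => p l * p r
  | Or ch => \sum_(e <- ch) e.2 * p e.1
  end.

(* The children of an AND gate are evaluated at the whole assignment: the value
   at a node only depends on the restriction to its scope. *)
Definition pc_val c x : nat -> R := eval 0 (pc_step x) c.

Definition rc_step c x (g : gate d R) (out : nat -> R) : R :=
  match g with
  | Lit _ _ => 0
  | And l r => out l + out r
  | Or ch => \sum_(e <- ch) (sat c x e.1)%:R * (e.2 + out e.1)
  end.

Definition rc_val c x : nat -> R := eval 0 (rc_step c x) c.

Definition weighted c : Prop :=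
  forall i ch, onth c i = Some (Or ch) ->
    all (fun e => 0 <= e.2) ch /\ \sum_(e <- ch) e.2 = 1.

(* The root depends on every variable, so that it defines a distribution on the
   assignments of all the variables. *)
Definition is_PC (t : vtree d) c : Prop :=
  [/\ wf_circuit c, smooth c, structured t c, weighted c
    & scope c (root_node c) = setT].

Definition is_RC (t : vtree d) c : Prop :=
  [/\ wf_circuit c, smooth c, structured t c & deterministic c].

Definition pc_dist c : assignment d -> R := fun x => pc_val c x (root_node c).

Definition rc_out c : assignment d -> R := fun x => rc_val c x (root_node c).

Definition expectation (p f : assignment d -> R) : R := \sum_x p x * f x.

Definition moment (k : nat) (f p : assignment d -> R) : R :=
  expectation p (fun x => f x ^+ k).

End Values.

Lemma scope_local d R : local_step (@scope_step d R).
Proof.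
case=> [v b|l r|ch] f f' ff' //=; first by rewrite !ff' ?inE ?eqxx ?orbT.
elim: ch ff' => [|e ch IH] ff'; rewrite ?big_nil // !big_cons ff' ?mem_head //.
by rewrite IH // => j jch; apply: ff'; rewrite inE jch orbT.
Qed.

Lemma sat_local d R (x : assignment d) : local_step (@sat_step d R x).
Proof.
case=> [v b|l r|ch] f f' ff' //=; first by rewrite !ff' ?inE ?eqxx ?orbT.
elim: ch ff' => //= e ch IH ff'; rewrite ff' ?mem_head // IH //.
by move=> j jch; apply: ff'; rewrite inE jch orbT.
Qed.

Lemma pc_local d (R : realFieldType) (x : assignment d) :
  local_step (@pc_step d R x).
Proof.
case=> [v b|l r|ch] f f' ff' //=; first by rewrite !ff' ?inE ?eqxx ?orbT.
by apply: eq_big_seq => e ech; rewrite ff' // map_f.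
Qed.

Lemma rc_local d (R : realFieldType) c (x : assignment d) :
  local_step (@rc_step d R c x).
Proof.
case=> [v b|l r|ch] f f' ff' //=; first by rewrite !ff' ?inE ?eqxx ?orbT.
by apply: eq_big_seq => e ech; rewrite ff' // map_f.
Qed.

(** * A unit-cost random access machine over numbers *)

(* Programs use index registers and arrays (holding naturals) and number
   registers and arrays (holding elements of [R]).  Registers and arrays are
   named by literals, so that each program uses finitely many of them; entries of
   arrays are addressed by the content of an index register.  A program mentions
   no element of [R] but 0 and 1, and the same program runs over any [R]. *)
Inductive instr :=
| IConst of nat & nat            (* ireg r := n *)
| IAdd of nat & nat & nat        (* ireg r := ireg a + ireg b *)
| ISub of nat & nat & nat        (* ireg r := ireg a - ireg b, truncated *)
| ILoad of nat & nat & nat       (* ireg r := iarr A [ireg a] *)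
| IStore of nat & nat & nat      (* iarr A [ireg a] := ireg r *)
| RConst of nat & bool           (* rreg r := 0 or 1 *)
| RAdd of nat & nat & nat        (* rreg r := rreg a + rreg b *)
| RSub of nat & nat & nat        (* rreg r := rreg a - rreg b *)
| RMul of nat & nat & nat        (* rreg r := rreg a * rreg b *)
| RLoad of nat & nat & nat       (* rreg r := rarr A [ireg a] *)
| RStore of nat & nat & nat.     (* rarr A [ireg a] := rreg r *)

Inductive cmd :=
| Instr of instr
| Seq of cmd & cmd
| IfLt of nat & nat & cmd & cmd  (* if ireg a < ireg b *)
| WhileLt of nat & nat & cmd.    (* while ireg a < ireg b *)

Section Machine.
Context {R : realFieldType}.

Record state := State {
  ireg : nat -> nat;
  rreg : nat -> R;
  iarr : nat -> nat -> nat;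
  rarr : nat -> nat -> R
}.

Definition upd (T : Type) (f : nat -> T) (i : nat) (v : T) : nat -> T :=
  fun j => if j == i then v else f j.

Definition set_ireg s r v := State (upd (ireg s) r v) (rreg s) (iarr s) (rarr s).
Definition set_rreg s r v := State (ireg s) (upd (rreg s) r v) (iarr s) (rarr s).
Definition set_iarr s A i v :=
  State (ireg s) (rreg s) (upd (iarr s) A (upd (iarr s A) i v)) (rarr s).
Definition set_rarr s A i v :=
  State (ireg s) (rreg s) (iarr s) (upd (rarr s) A (upd (rarr s A) i v)).

Definition exec_instr (o : instr) (s : state) : state :=
  match o with
  | IConst r n => set_ireg s r n
  | IAdd r a b => set_ireg s r (ireg s a + ireg s b)%N
  | ISub r a b => set_ireg s r (ireg s a - ireg s b)%N
  | ILoad r A a => set_ireg s r (iarr s A (ireg s a))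
  | IStore A a r => set_iarr s A (ireg s a) (ireg s r)
  | RConst r b => set_rreg s r b%:R
  | RAdd r a b => set_rreg s r (rreg s a + rreg s b)
  | RSub r a b => set_rreg s r (rreg s a - rreg s b)
  | RMul r a b => set_rreg s r (rreg s a * rreg s b)
  | RLoad r A a => set_rreg s r (rarr s A (ireg s a))
  | RStore A a r => set_rarr s A (ireg s a) (rreg s r)
  end.

(* [exec c s t s']: run from [s], [c] stops in [s'] after [t] steps, a step being
   an instruction or a test. *)
Inductive exec : cmd -> state -> nat -> state -> Prop :=
| ExecInstr o s : exec (Instr o) s 1 (exec_instr o s)
| ExecSeq c1 c2 s t1 s1 t2 s2 :
    exec c1 s t1 s1 -> exec c2 s1 t2 s2 -> exec (Seq c1 c2) s (t1 + t2) s2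
| ExecIfTrue a b c1 c2 s t s' :
    (ireg s a < ireg s b)%N -> exec c1 s t s' -> exec (IfLt a b c1 c2) s t.+1 s'
| ExecIfFalse a b c1 c2 s t s' :
    (ireg s b <= ireg s a)%N -> exec c2 s t s' -> exec (IfLt a b c1 c2) s t.+1 s'
| ExecWhileTrue a b c s t1 s1 t2 s2 :
    (ireg s a < ireg s b)%N -> exec c s t1 s1 -> exec (WhileLt a b c) s1 t2 s2 ->
    exec (WhileLt a b c) s (t1 + t2).+1 s2
| ExecWhileFalse a b c s :
    (ireg s b <= ireg s a)%N -> exec (WhileLt a b c) s 1 s.

Lemma exec_det c s t1 s1 t2 s2 :
  exec c s t1 s1 -> exec c s t2 s2 -> t1 = t2 /\ s1 = s2.
Proof.
move=> e1; elim: e1 t2 s2 => {c s t1 s1}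
  [o s|c1 c2 s t1 s1 t2 s2 _ IH1 _ IH2|a b c1 c2 s t s' lt _ IH
  |a b c1 c2 s t s' le _ IH|a b c s t1 s1 t2 s2 lt _ IH1 _ IH2|a b c s le]
  u v e; inversion e as [|? ? ? ? ? ? ? f1 f2|? ? ? ? ? ? ? l f|? ? ? ? ? ? ? l f
    |? ? ? ? ? ? ? ? l f1 f2|? ? ? ? l]; subst => //;
  try by [move: l; rewrite leqNgt lt | move: l; rewrite ltnNge le].
- by have [? ?] := IH1 _ _ f1; subst; have [-> ->] := IH2 _ _ f2.
- by have [-> ->] := IH _ _ f.
- by have [-> ->] := IH _ _ f.
- by have [? ?] := IH1 _ _ f1; subst; have [-> ->] := IH2 _ _ f2.
Qed.

End Machine.

Arguments state : clear implicits.

(** * Input of the machine *)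

Section Encoding.
Context {d : nat} {R : realFieldType}.
Implicit Type c : circuit d R.

Definition all_or_inputs c : seq (nat * R) := flatten (map or_inputs c).

Definition gate_tag c i : nat :=
  match onth c i with
  | Some (And _ _) => 1
  | Some (Or _) => 2
  | _ => 0
  end.

(* An OR gate is stored as the slice of [all_or_inputs c] holding its inputs,
   given by its starting point and its length. *)
Definition field1 c i : nat :=
  match onth c i with
  | Some (Lit v _) => v
  | Some (And l _) => l
  | Some (Or _) => size (all_or_inputs (take i c))
  | None => 0
  end.

Definition field2 c i : nat :=
  match onth c i with
  | Some (Lit _ b) => b
  | Some (And _ r) => r
  | Some (Or ch) => size ch
  | None => 0
  end.

Definition or_child c e : nat := (nth (0%N, 0) (all_or_inputs c) e).1.
Definition or_param c e : R := (nth (0%N, 0) (all_or_inputs c) e).2.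

Definition input (k : nat) (pc rc : circuit d R) : state R :=
  State (nth 0%N [:: k; size pc; size rc])
        (fun _ => 0)
        (nth (fun _ => 0%N)
           [:: gate_tag pc; field1 pc; field2 pc; or_child pc;
               gate_tag rc; field1 rc; field2 rc; or_child rc])
        (nth (fun _ => 0) [:: or_param pc; or_param rc]).

Definition output (s : state R) : R := rreg s 0.

End Encoding.

(* Main.v *)
(* For a PC node n write E_n for the expectation under the distribution that n
   defines on its scope, and for an RC node m with scope m included in scope n put
   W(n, m, i) = E_n[1_m * g_m ^ i].  Expanding powers of sums gives
   - for an OR gate m, by determinism,
       W(n, m, i) = sum_j sum_a C(i, a) * W(n, j, a) * phi_j ^ (i - a);
   - for an OR gate n, W(n, m, i) = sum_j theta_j * W(j, m, i);
   - for AND gates n = (L, R) and m = (L', R'), the vtree forces scope m to lie in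
     scope L or in scope R, in which case W(n, m, .) is W(L, m, .) or W(R, m, .), or
     scope L' to lie in scope L and scope R' in scope R, in which case
       W(n, m, i) = sum_a C(i, a) * W(L, L', a) * W(R, R', i - a).
   An RC whose root is an AND gate does not output 0 on the assignments that falsify
   it, so the same moments without 1_m are tabulated as well.  A pair (n, m) costs at
   most O(k^2 (1 + deg n + deg m)), and a circuit has at most one more node than
   edges, whence the total time. *)

Require Import Defs.
From HB Require Import structures.
From mathcomp Require Import all_boot all_order all_algebra.
From mathcomp Require Import zify ring.

Set Implicit Arguments.
Unset Strict Implicit.
Unset Printing Implicit Defensive.

(** * Averages over assignments *)

(** Scopes vary from gate to gate while assignments are total. The uniform average over all
    assignments, weighted by 2 to the size of the scope, gives the expectation under a node without
    any partial assignment, and independence of disjoint scopes becomes a product formula for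
    averages. The program stores no scopes: inclusion of scopes is a flag computed by the same
    recursion as the moments, whose correctness is conditional on it. The recurrences at OR gates
    and the plain copies are one operation, adding to a row the binomial convolution of another row
    with a geometric sequence theta * psi ^ j: (theta, psi) is (1, phi) at an OR gate of the RC,
    (theta, 0) at one of the PC and (1, 0) for a copy. Accumulating in place is sound because memory
    starts at 0 and the pairs are visited in an order in which every recurrence looks back only. *)

Section Average.
Import GRing.Theory Num.Theory.
Local Open Scope ring_scope.
Variables (d : nat) (R : realFieldType).
Implicit Types (F G : assignment d -> R) (A B : {set 'I_d}) (x y : assignment d).

Definition depends_on (T : Type) A (F : assignment d -> T) : Prop :=
  forall x y, {in A, x =1 y} -> F x = F y.

Lemma depends_onS (T : Type) A B (F : assignment d -> T) :
  A \subset B -> depends_on A F -> depends_on B F.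
Proof. by move=> /subsetP AB dF x y xy; apply: dF => v /AB/xy. Qed.

Lemma depends_onM A F G :
  depends_on A F -> depends_on A G -> depends_on A (fun x => F x * G x).
Proof. by move=> dF dG x y xy; rewrite (dF x y xy) (dG x y xy). Qed.

Definition avg F : R := (\sum_x F x) / 2 ^+ d.

Lemma exp2_neq0 n : (2 ^+ n : R) != 0.
Proof. by rewrite expf_eq0 pnatr_eq0 andbF. Qed.

Lemma sum_assignment1 : \sum_(x : assignment d) 1 = 2 ^+ d :> R.
Proof. by rewrite sumr_const card_ffun card_bool card_ord natrX. Qed.

Lemma eq_avg F G : F =1 G -> avg F = avg G.
Proof. by move=> FG; rewrite /avg (eq_bigr _ (fun x _ => FG x)). Qed.

Lemma avgZ a F : avg (fun x => a * F x) = a * avg F.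
Proof. by rewrite /avg -mulr_sumr mulrA. Qed.

Lemma avg_cst1 : avg (fun=> 1) = 1.
Proof. by rewrite /avg sum_assignment1 divff // exp2_neq0. Qed.

Lemma avg_sum (I : Type) (s : seq I) (F : I -> assignment d -> R) :
  avg (fun x => \sum_(e <- s) F e x) = \sum_(e <- s) avg (F e).
Proof. by rewrite /avg exchange_big mulr_suml. Qed.

(* Exchanging the restrictions to A of two assignments is an involution of pairs,
   and turns F x * G y into F x * G x. *)
Lemma avg_indep A B F G : [disjoint A & B] -> depends_on A F -> depends_on B G ->
  avg (fun x => F x * G x) = avg F * avg G.
Proof.
move=> dAB dF dG.
pose mix x y : assignment d := [ffun v => if v \in A then x v else y v].
pose sw (z : assignment d * assignment d) := (mix z.1 z.2, mix z.2 z.1).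
have swK : involutive sw.
  case=> x y; rewrite /sw /=; congr (_, _); apply/ffunP => v; rewrite !ffunE.
    by case: (v \in A).
  by case: (v \in A).
have key : (\sum_x F x) * (\sum_y G y) = 2 ^+ d * \sum_x F x * G x.
  transitivity (\sum_z F (sw z).1 * G (sw z).2).
    rewrite big_distrlr pair_bigA /= (reindex_inj (inv_inj swK)) /=.
    by apply: eq_bigr.
  transitivity (\sum_(z : assignment d * assignment d) F z.1 * G z.1).
    apply: eq_bigr => -[x y] _ /=; congr (_ * _).
      by apply: dF => v vA; rewrite ffunE vA.
    by apply: dG => v vB; rewrite ffunE (disjointFl dAB).
  rewrite -(pair_bigA _ (fun x _ => F x * G x)) /= exchange_big /=.
  by rewrite -sum_assignment1 mulr_suml; apply: eq_bigr => y _; rewrite mul1r.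
by rewrite /avg mulrACA key mulrACA divff ?exp2_neq0 // mul1r.
Qed.

(** Flipping the value of [v] exchanges the two literals, whose indicators sum to 1. The factor 2 is
    the weight of a one-variable scope. *)
Lemma avg_literal (v : 'I_d) b : 2 * avg (fun x => (x v == b)%:R) = 1.
Proof.
pose flip x : assignment d := [ffun w => if w == v then ~~ x w else x w].
have flipK : involutive flip.
  by move=> x; apply/ffunP => w; rewrite !ffunE; case: eqP => // _; rewrite negbK.
rewrite mulr2n mulrDl mul1r -[X in X + _](_ : avg (fun x => (x v != b)%:R) = _).
  rewrite /avg -mulrDl -big_split /= -[RHS]avg_cst1; congr (_ / _).
  by apply: eq_bigr => x _; case: eqP; rewrite ?addr0 ?add0r.
rewrite /avg (reindex_inj (inv_inj flipK)) /=; congr (_ / _).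
by apply: eq_bigr => x _; rewrite ffunE eqxx; case: (x v) b => [] [].
Qed.

End Average.

(** * Scopes and vtrees *)

Section Structure.
Variables (d : nat) (R : realFieldType) (c : circuit d R).
Hypothesis wfc : wf_circuit c.

Lemma child_lt i g j : onth c i = Some g -> j \in children g -> j < i.
Proof. by case: wfc => _ H _ _ /H/allP; apply. Qed.

Lemma gate_at i : i < size c -> exists g, onth c i = Some g.
Proof. by rewrite -onthTE; case: onth => // g _; exists g. Qed.

Lemma onth_lt i g : onth c i = Some g -> i < size c.
Proof. by move=> E; rewrite -onthTE E. Qed.

Lemma circuit_ind (P : nat -> Prop) :
  (forall i g, onth c i = Some g -> {in children g, forall j, P j} -> P i) ->
  forall i, i < size c -> P i.
Proof.
move=> H; elim/ltn_ind => i IH ilt; have [g gi] := gate_at ilt.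
by apply: (H _ _ gi) => j /(child_lt gi) ji; apply: IH => //; apply: ltn_trans ilt.
Qed.

Lemma scopeE i g : onth c i = Some g -> scope c i = scope_step g (scope c).
Proof. by move=> gi; apply: evalE => //; apply: scope_local. Qed.

Lemma satE x i g : onth c i = Some g -> sat c x i = sat_step x g (sat c x).
Proof. by move=> gi; apply: evalE => //; apply: sat_local. Qed.

Lemma or_inputs_neq0 i ch : onth c i = Some (Or ch) -> ch <> [::].
Proof. by case: wfc => _ _ H _ /H[]. Qed.

(** An empty scope would lie on both sides of any vtree node, which would spoil the alignment of AND
    gates. *)
Lemma scope_neq0 i : i < size c -> scope c i != set0.
Proof.
elim/circuit_ind => {}i g gi IH; rewrite (scopeE gi).
case: g gi IH => [v b|l r|[|[j a] ch]] gi IH /=.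
- by apply/set0Pn; exists v; rewrite inE.
- by rewrite setU_eq0 negb_and IH // inE eqxx.
- by case: (or_inputs_neq0 gi).
by rewrite big_cons setU_eq0 negb_and IH // inE eqxx.
Qed.

Lemma scope_or i ch j : smooth c -> onth c i = Some (Or ch) ->
  j \in map fst ch -> scope c i = scope c j.
Proof.
move=> sm gi jch; rewrite (scopeE gi) /=.
apply/eqP; rewrite eqEsubset; apply/andP; split.
  rewrite big_seq; elim/big_ind: _ => [|A B sA sB|e ech]; rewrite ?sub0set //.
    by rewrite subUset sA.
  by rewrite (sm _ _ gi e.1 j) // map_f.
case/mapP: jch => e ech ->.
by rewrite (big_rem e ech) /= subsetUl.
Qed.

(** Every node but the root occurs among the children of some gate. *)
Lemma size_circuit : size c <= (num_edges c).+1.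
Proof.
have -> : num_edges c = size (flatten (map children c)).
  rewrite size_flatten /shape -map_comp /num_edges sumnE big_map.
  by apply: eq_bigr.
case: wfc => c0 _ _ src.
suff : {subset iota 0 (root_node c) <= flatten (map children c)}.
  move/(uniq_leq_size (iota_uniq _ _)); rewrite size_iota /root_node.
  by case: (size c).
move=> i; rewrite mem_iota add0n => /src[j [g [gj ig]]].
apply/flattenP; exists (children g) => //; apply/onthP; exists j.
by rewrite onth_map gj.
Qed.


Lemma sat_depends i : i < size c -> depends_on (scope c i) (fun x => sat c x i).
Proof.
elim/circuit_ind => {}i g gi IH; rewrite (scopeE gi) => x y xy.
rewrite !(satE _ gi); case: g gi IH xy => [v b|l r|ch] gi IH /= xy.
- by rewrite xy // inE.
- rewrite (IH l _ x y) ?(IH r _ x y) ?inE ?eqxx ?orbT // => v vs; apply: xy;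
    by rewrite inE vs ?orbT.
apply: eq_in_has => e ech; apply: IH => [|v ve]; first exact: map_f.
by apply: xy; rewrite (big_rem e ech) inE ve.
Qed.

End Structure.

(** * Relative position of two AND gates in a vtree *)

Section Vtree.
Variable d : nat.
Implicit Types (t : vtree d) (A B C D : {set 'I_d}).

Lemma splits_sub t A B : splits t A B ->
  (A \subset vleaves t) && (B \subset vleaves t).
Proof.
elim: t => //= l IHl r IHr /or3P[/andP[Al Br]|/IHl/andP[Al Bl]|/IHr/andP[Ar Br]].
- apply/andP; split; apply/subsetP => v; rewrite mem_cat.
    by move/(subsetP Al) => ->.
  by move/(subsetP Br) => ->; rewrite orbT.
- by apply/andP; split; apply/subsetP => v; rewrite mem_cat;
    [move/(subsetP Al)|move/(subsetP Bl)] => ->.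
by apply/andP; split; apply/subsetP => v; rewrite mem_cat;
  [move/(subsetP Ar)|move/(subsetP Br)] => ->; rewrite orbT.
Qed.

Lemma sub_left A B C (s : seq 'I_d) : C \subset A :|: B -> C \subset s ->
  {in B, forall v, v \notin s} -> C \subset A.
Proof.
move=> CAB Cs Bs; apply/subsetP => v vC; move/subsetP/(_ v vC): CAB.
rewrite inE => /orP[//|/Bs]; by rewrite (subsetP Cs _ vC).
Qed.

Lemma nosub A B C (s : seq 'I_d) : C != set0 -> C \subset A :|: B -> C \subset s ->
  {in A, forall v, v \notin s} -> {in B, forall v, v \notin s} -> False.
Proof.
case/set0Pn => v vC CAB Cs As Bs; move/subsetP/(_ v vC): CAB.
by rewrite inE => /orP[/As|/Bs]; rewrite (subsetP Cs _ vC).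
Qed.

(** The vtree node separating [C] from [D] is either the one separating [A] from [B] or lies in one
    of its branches. Were it above, or in another subtree, [C] or [D] would share no variable with
    [A :|: B], though nonempty and included in it. *)
Lemma splits_align t A B C D : uniq (vleaves t) ->
  splits t A B -> splits t C D -> C != set0 -> D != set0 ->
  C :|: D \subset A :|: B ->
  [\/ C :|: D \subset A, C :|: D \subset B | C \subset A /\ D \subset B].
Proof.
elim: t => //= l IHl r IHr; rewrite cat_uniq => /and3P[ul /hasPn lr ur].
have rl v : v \in vleaves l -> v \notin vleaves r by apply: contraL => /lr.
have inl (X : {set 'I_d}) : X \subset vleaves l -> {in X, forall v, v \notin vleaves r}.
  by move=> /subsetP X1 v /X1/rl.
have inr (X : {set 'I_d}) : X \subset vleaves r -> {in X, forall v, v \notin vleaves l}.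
  by move=> /subsetP X1 v /X1/lr.
move=> sAB sCD C0 D0 sub; have := sub; rewrite subUset => /andP[CAB DAB].
have subBA (X : {set 'I_d}) : X \subset A :|: B -> X \subset B :|: A by rewrite setUC.
case/or3P: sAB => [/andP[Al Br]|sAB|sAB]; case/or3P: sCD => [/andP[Cl Dr]|sCD|sCD].
- apply: Or33; split; first exact: (sub_left CAB Cl (inr _ Br)).
  exact: (sub_left (subBA _ DAB) Dr (inl _ Al)).
- apply: Or31; case/andP: (splits_sub sCD) => Cl Dl.
  by rewrite subUset (sub_left CAB Cl (inr _ Br)) (sub_left DAB Dl (inr _ Br)).
- apply: Or32; case/andP: (splits_sub sCD) => Cl Dl; rewrite subUset.
  rewrite (sub_left (subBA _ CAB) Cl (inl _ Al)).
  by rewrite (sub_left (subBA _ DAB) Dl (inl _ Al)).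
- case/andP: (splits_sub sAB) => Al Bl.
  by case: (nosub D0 DAB Dr (inl _ Al) (inl _ Bl)).
- exact: IHl.
- case/andP: (splits_sub sAB) => Al Bl; case/andP: (splits_sub sCD) => Cr Dr.
  by case: (nosub D0 DAB Dr (inl _ Al) (inl _ Bl)).
- case/andP: (splits_sub sAB) => Ar Br.
  by case: (nosub C0 CAB Cl (inr _ Ar) (inr _ Br)).
- case/andP: (splits_sub sAB) => Ar Br; case/andP: (splits_sub sCD) => Cl Dl.
  by case: (nosub C0 CAB Cl (inr _ Ar) (inr _ Br)).
exact: IHr.
Qed.

End Vtree.

(** * Moments at pairs of nodes *)

Section Moments.
Import GRing.Theory Num.Theory.
Local Open Scope ring_scope.
Variables (d : nat) (R : realFieldType) (t : vtree d) (pc rc : circuit d R).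
Hypotheses (wft : wf_vtree t) (PC : is_PC t pc) (RC : is_RC t rc).

Let wfp : wf_circuit pc. Proof. by case: PC. Qed.
Let wfr : wf_circuit rc. Proof. by case: RC. Qed.

Lemma pc_valE x i g : onth pc i = Some g -> pc_val pc x i = pc_step x g (pc_val pc x).
Proof. by move=> gi; apply: evalE => //; apply: pc_local. Qed.

Lemma rc_valE x i g : onth rc i = Some g ->
  rc_val rc x i = rc_step rc x g (rc_val rc x).
Proof. by move=> gi; apply: evalE => //; apply: rc_local. Qed.

Lemma pc_depends n : (n < size pc)%N ->
  depends_on (scope pc n) (fun x => pc_val pc x n).
Proof.
elim/(circuit_ind wfp) => {}i g gi IH; rewrite (scopeE wfp gi) => x y xy.
rewrite !(pc_valE _ gi); case: g gi IH xy => [v b|l r|ch] gi IH /= xy.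
- by rewrite xy // inE.
- rewrite (IH l _ x y) ?(IH r _ x y) ?inE ?eqxx ?orbT // => v vs; apply: xy;
    by rewrite inE vs ?orbT.
apply: eq_big_seq => e ech; congr (_ * _); apply: IH => [|v ve]; first exact: map_f.
by apply: xy; rewrite (big_rem e ech) inE ve.
Qed.

Lemma rc_depends m : (m < size rc)%N ->
  depends_on (scope rc m) (fun x => rc_val rc x m).
Proof.
elim/(circuit_ind wfr) => {}i g gi IH; rewrite (scopeE wfr gi) => x y xy.
rewrite !(rc_valE _ gi); case: g gi IH xy => [v b|l r|ch] gi IH //= xy.
- rewrite (IH l _ x y) ?(IH r _ x y) ?inE ?eqxx ?orbT // => v vs; apply: xy;
    by rewrite inE vs ?orbT.
apply: eq_big_seq => e ech.
have ech1 : e.1 \in map fst ch by apply: map_f.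
have xye : {in scope rc e.1, x =1 y}.
  by move=> v ve; apply: xy; rewrite (big_rem e ech) inE ve.
rewrite (IH _ ech1 _ _ xye) (sat_depends wfr _ xye) //.
exact: ltn_trans (child_lt wfr gi ech1) (onth_lt gi).
Qed.

(* The expectation of f under node n as a distribution on the assignments of its
   scope, provided that f depends on this scope only. *)
Definition Enode n (f : assignment d -> R) : R :=
  2 ^+ #|scope pc n| * avg (fun x => pc_val pc x n * f x).

(* With fl, the moments are those of the output truncated to the assignments
   satisfying m, which are those propagating through OR gates. *)
Definition powval (fl : bool) m i x : R :=
  (fl ==> sat rc x m)%:R * rc_val rc x m ^+ i.

Definition W fl n m i : R := Enode n (powval fl m i).

Lemma eq_Enode n f f' : f =1 f' -> Enode n f = Enode n f'.
Proof. by move=> ff; rewrite /Enode; congr (_ * _); apply: eq_avg => x; rewrite ff. Qed.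

Lemma EnodeZ n a f : Enode n (fun x => a * f x) = a * Enode n f.
Proof.
rewrite /Enode [RHS]mulrCA -(avgZ a); congr (_ * _); apply: eq_avg => x.
by rewrite mulrCA.
Qed.

Lemma Enode_sum (I : Type) n (s : seq I) (F : I -> assignment d -> R) :
  Enode n (fun x => \sum_(e <- s) F e x) = \sum_(e <- s) Enode n (F e).
Proof.
rewrite /Enode -mulr_sumr -avg_sum; congr (_ * _); apply: eq_avg => x.
by rewrite mulr_sumr.
Qed.

(** Smoothness gives [n] and its inputs the same scope, hence the same weight. *)
Lemma Enode_or n ch f : onth pc n = Some (Or ch) ->
  Enode n f = \sum_(e <- ch) e.2 * Enode e.1 f.
Proof.
case: PC => _ sm _ _ _ gn.
rewrite /Enode (@eq_avg _ _ _ (fun x => \sum_(e <- ch) e.2 * (pc_val pc x e.1 * f x))).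
  rewrite avg_sum mulr_sumr; apply: eq_big_seq => e ech.
  by rewrite avgZ mulrCA (scope_or wfp sm gn (map_f fst ech)).
move=> x; rewrite (pc_valE _ gn) /= mulr_suml.
by apply: eq_bigr => e _; rewrite mulrA.
Qed.

(** By decomposability the sizes of the scopes add up, so the weights multiply, and the average
    factors by [avg_indep]. *)
Lemma Enode_and n l r f f' : onth pc n = Some (And l r) ->
  depends_on (scope pc l) f -> depends_on (scope pc r) f' ->
  Enode n (fun x => f x * f' x) = Enode l f * Enode r f'.
Proof.
move=> gn df df'; have [_ _ st _ _] := PC.
have dis := structured_decomposable wft st gn.
have [lt rt] : (l < size pc /\ r < size pc)%N.
  by split; apply: ltn_trans (onth_lt gn); apply: (child_lt wfp gn);
    rewrite !inE eqxx ?orbT.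
rewrite /Enode (scopeE wfp gn) /= cardsU (disjoint_setI0 dis) cards0 subn0.
rewrite exprD [RHS]mulrACA -(avg_indep dis); last 2 first.
- by apply: depends_onM => //; apply: pc_depends.
- by apply: depends_onM => //; apply: pc_depends.
congr (_ * _); apply: eq_avg => x.
by rewrite (pc_valE _ gn) /= mulrACA.
Qed.

(** This normalisation lets an AND gate of the PC drop the branch on which [m] does not depend, and
    gives the zeroth moment without indicator. *)
Lemma Enode1 n : (n < size pc)%N -> Enode n (fun=> 1) = 1.
Proof.
elim/(circuit_ind wfp) => {}n g gn IH; case: g gn IH => [v b|l r|ch] gn IH.
- rewrite /Enode (scopeE wfp gn) /= cards1 expr1 -[RHS](avg_literal R v b).
  by congr (_ * _); apply: eq_avg => x; rewrite (pc_valE _ gn) mulr1.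
- rewrite (@eq_Enode _ _ (fun=> 1 * 1)) => [|x]; last by rewrite mulr1.
  by rewrite (@Enode_and _ _ _ (fun=> 1) (fun=> 1) gn) // !IH ?mulr1 // !inE eqxx ?orbT.
rewrite (Enode_or _ gn); have [_ _ _ /(_ _ _ gn)[_ sum1] _] := PC.
rewrite -[RHS]sum1.
by apply: eq_big_seq => e ech; rewrite IH ?mulr1 // map_f.
Qed.

(** * Recurrences for the moments *)

Lemma W_rc_or n m ch i : onth rc m = Some (Or ch) ->
  W true n m i = \sum_(e <- ch) \sum_(a < i.+1)
    'C(i, a)%:R * W true n e.1 a * e.2 ^+ (i - a).
Proof.
move=> gm; rewrite /W (@eq_Enode _ _ (fun x => \sum_(e <- ch) \sum_(a < i.+1)
    ('C(i, a)%:R * e.2 ^+ (i - a)) * powval true e.1 a x)).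
  rewrite Enode_sum; apply: eq_bigr => e _; rewrite Enode_sum.
  by apply: eq_bigr => a _; rewrite EnodeZ mulrAC.
(* At most one input is satisfied by [x], so the power of the sum is a sum of powers. The indicator
   in front keeps this true for [i = 0] when no input is satisfied. *)
move=> x; transitivity (\sum_(e <- ch) (sat rc x e.1)%:R * (e.2 + rc_val rc x e.1) ^+ i).
  rewrite /powval (rc_valE _ gm) (satE wfr _ gm) /=.
  have [/hasP[e ech sate]|/hasPn nsat] := boolP (has _ _); last first.
    by rewrite mul0r big1_seq // => e /andP[_ /nsat/negbTE ->]; rewrite mul0r.
  case: (RC) => _ _ _ /(_ _ _ gm x) det.
  have [_ uch] : ch <> [::] /\ uniq (map fst ch) by case: wfr => _ _ /(_ _ _ gm).
  (* Determinism only identifies node numbers; these are distinct along [ch], so the entries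
     coincide together with their parameters. *)
  have other e' : e' \in ch -> e' != e -> sat rc x e'.1 = false.
    move=> e'ch; apply: contraNF => sate'; apply/eqP.
    have e1 : e'.1 = e.1 by apply: det => //; apply: map_f.
    rewrite -[e](nth_index (0%N, 0) ech) -[e'](nth_index (0%N, 0) e'ch).
    congr nth; have := e1; rewrite -[e in RHS](nth_index (0%N, 0) ech).
    rewrite -[e' in LHS](nth_index (0%N, 0) e'ch).
    rewrite -!(nth_map _ 0%N) ?index_mem // => /eqP.
    by rewrite nth_uniq ?size_map ?index_mem // => /eqP.
  rewrite !(bigD1_seq e ech (map_uniq uch)) /= sate !mul1r.
  rewrite !big1_seq ?addr0 // => e' /andP[ne ch']; by rewrite (other e') ?mul0r.
apply: eq_bigr => e _; rewrite exprDn mulr_sumr; apply: eq_bigr => a _.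
by rewrite /powval /= -mulr_natl; ring.
Qed.


(** The output of an OR gate vanishes where the gate is not satisfied, so the indicator only matters
    for the power 0, where [0 ^+ 0 = 1]. *)
Lemma W_false_or n m ch i : (n < size pc)%N -> onth rc m = Some (Or ch) ->
  W false n m i = if i is 0 then 1 else W true n m i.
Proof.
move=> nlt gm; case: i => [|i].
  by rewrite /W (@eq_Enode _ _ (fun=> 1)) ?Enode1 // => x; rewrite /powval expr0 mul1r.
apply: eq_Enode => x; rewrite /powval /= mul1r; have [|] := boolP (sat _ _ _).
  by rewrite mul1r.
rewrite (satE wfr _ gm) (rc_valE _ gm) /= => /hasPn nsat.
by rewrite big1_seq ?exprS ?mul0r // => e /andP[_ /nsat/negbTE ->]; rewrite mul0r.
Qed.

Lemma W_pc_or fl n m ch i : onth pc n = Some (Or ch) ->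
  W fl n m i = \sum_(e <- ch) e.2 * W fl e.1 m i.
Proof. by move=> gn; apply: Enode_or. Qed.

Lemma powval_depends fl m i : (m < size rc)%N ->
  depends_on (scope rc m) (powval fl m i).
Proof.
move=> mlt x y xy; rewrite /powval (rc_depends mlt xy).
by case: fl => //=; rewrite (sat_depends wfr mlt xy).
Qed.

Lemma pc_and_lt n l r : onth pc n = Some (And l r) -> (l < n)%N /\ (r < n)%N.
Proof. by move=> gn; split; apply: (child_lt wfp gn); rewrite !inE eqxx ?orbT. Qed.

Lemma rc_and_lt n l r : onth rc n = Some (And l r) -> (l < n)%N /\ (r < n)%N.
Proof. by move=> gn; split; apply: (child_lt wfr gn); rewrite !inE eqxx ?orbT. Qed.

Lemma W_and_left fl n l r m i : onth pc n = Some (And l r) -> (m < size rc)%N ->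
  scope rc m \subset scope pc l -> W fl n m i = W fl l m i.
Proof.
move=> gn mlt sml; have [_ rn] := pc_and_lt gn.
rewrite /W (@eq_Enode _ _ (fun x => powval fl m i x * 1)) => [|x]; last by rewrite mulr1.
rewrite (@Enode_and _ _ _ _ (fun=> 1) gn) ?Enode1 ?mulr1 //.
  exact: ltn_trans rn (onth_lt gn).
exact: depends_onS sml (powval_depends _ _ mlt).
Qed.

Lemma W_and_right fl n l r m i : onth pc n = Some (And l r) -> (m < size rc)%N ->
  scope rc m \subset scope pc r -> W fl n m i = W fl r m i.
Proof.
move=> gn mlt smr; have [ln _] := pc_and_lt gn.
rewrite /W (@eq_Enode _ _ (fun x => 1 * powval fl m i x)) => [|x]; last by rewrite mul1r.
rewrite (@Enode_and _ _ _ (fun=> 1) _ gn) ?Enode1 ?mul1r //.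
  exact: ltn_trans ln (onth_lt gn).
exact: depends_onS smr (powval_depends _ _ mlt).
Qed.

Lemma W_and_and fl n l r m ml mr i :
  onth pc n = Some (And l r) -> onth rc m = Some (And ml mr) ->
  scope rc ml \subset scope pc l -> scope rc mr \subset scope pc r ->
  W fl n m i =
    \sum_(a < i.+1) 'C(i, a)%:R * W fl l ml a * W fl r mr (i - a).
Proof.
move=> gn gm sl sr; have [mlm mrm] := rc_and_lt gm; have mlt := onth_lt gm.
rewrite /W (@eq_Enode _ _ (fun x => \sum_(a < i.+1)
    'C(i, a)%:R * (powval fl ml a x * powval fl mr (i - a) x))).
  rewrite Enode_sum; apply: eq_bigr => a _; rewrite EnodeZ (Enode_and gn) ?mulrA //.
    exact: depends_onS sl (powval_depends _ _ (ltn_trans mlm mlt)).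
  exact: depends_onS sr (powval_depends _ _ (ltn_trans mrm mlt)).
(* [exprDn] puts the exponent [a] on the second summand, so the sum is swapped to give it to [ml].
   The indicator of an AND gate is the product of those of its children. *)
move=> x; rewrite /powval (rc_valE _ gm) (satE wfr _ gm) /= addrC exprDn mulr_sumr.
apply: eq_bigr => a _; rewrite -mulr_natl.
by case: fl => /=; rewrite -?mulnb ?natrM; ring.
Qed.

Lemma W_lit_true n m v b b' i :
  onth pc n = Some (Lit v b) -> onth rc m = Some (Lit v b') ->
  W true n m i = ((b == b') && (i == 0%N))%:R.
Proof.
move=> gn gm; case: i => [|i]; last first.
  rewrite andbF /W (@eq_Enode _ _ (fun x => 0 * 1)) ?EnodeZ ?mul0r // => x.
  by rewrite /powval (rc_valE _ gm) /= exprS !mul0r mulr0.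
rewrite andbT /W /Enode (scopeE wfp gn) /= cards1 expr1.
rewrite (@eq_avg _ _ _ (fun x => (b == b')%:R * (x v == b)%:R)).
  by rewrite avgZ mulrCA avg_literal mulr1.
move=> x; rewrite /powval (pc_valE _ gn) (satE wfr _ gm) /= expr0 mulr1.
by move: (x v) b b' {gn gm} => [] [] []; rewrite ?mulr1 ?mulr0 ?mul0r.
Qed.

Lemma W_lit_false n m v b i : (n < size pc)%N -> onth rc m = Some (Lit v b) ->
  W false n m i = (i == 0%N)%:R.
Proof.
move=> nlt gm; case: i => [|i].
  by rewrite /W (@eq_Enode _ _ (fun=> 1)) ?Enode1 // => x; rewrite /powval expr0 mul1r.
rewrite /W (@eq_Enode _ _ (fun x => 0 * 1)) ?EnodeZ ?mul0r // => x.
by rewrite /powval (rc_valE _ gm) /= exprS !mul0r mulr0.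
Qed.

(** The root of the PC depends on all variables, so its weight cancels the denominator of the
    average. *)
Lemma moment_W k :
  moment k (rc_out rc) (pc_dist pc) = W false (root_node pc) (root_node rc) k.
Proof.
case: PC => _ _ _ _ full.
rewrite /W /Enode full cardsT card_ord /avg mulrCA divff ?exp2_neq0 // mulr1.
by apply: eq_bigr => x _; rewrite /powval mul1r.
Qed.

(** * Inclusion of scopes at pairs of gates *)

Lemma scope_and_and n l r m ml mr :
  onth pc n = Some (And l r) -> onth rc m = Some (And ml mr) ->
  ~~ (scope rc m \subset scope pc l) -> ~~ (scope rc m \subset scope pc r) ->
  (scope rc m \subset scope pc n) =
    (scope rc ml \subset scope pc l) && (scope rc mr \subset scope pc r).
Proof.
move=> gn gm; have [mlm mrm] := rc_and_lt gm; have mlt := onth_lt gm.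
have [_ _ stp _ _] := PC; have [_ _ str _] := RC.
rewrite (scopeE wfp gn) (scopeE wfr gm) /= => nl nr; apply/idP/andP => [sub|[sl sr]].
  have [|||||] := splits_align _ (stp _ _ _ gn) (str _ _ _ gm) _ _ sub => //.
  - by rewrite (perm_uniq wft) enum_uniq.
  - exact: scope_neq0 wfr _ (ltn_trans mlm mlt).
  - exact: scope_neq0 wfr _ (ltn_trans mrm mlt).
  - by move=> H; rewrite H in nl.
  - by move=> H; rewrite H in nr.
exact: setUSS.
Qed.

Lemma scope_and_lit n l r m v b :
  onth pc n = Some (And l r) -> onth rc m = Some (Lit v b) ->
  (scope rc m \subset scope pc n) =
    (scope rc m \subset scope pc l) || (scope rc m \subset scope pc r).
Proof.
by move=> gn gm; rewrite (scopeE wfp gn) (scopeE wfr gm) /= !sub1set inE.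
Qed.

(** The children of an AND gate have nonempty disjoint scopes, so the gate depends on at least two
    variables. *)
Lemma scope_lit_and n v b m ml mr :
  onth pc n = Some (Lit v b) -> onth rc m = Some (And ml mr) ->
  scope rc m \subset scope pc n = false.
Proof.
move=> gn gm; have [mlm mrm] := rc_and_lt gm; have mlt := onth_lt gm.
rewrite (scopeE wfp gn) (scopeE wfr gm) /= subUset.
have [_ _ str _] := RC; have dis := structured_decomposable wft str gm.
apply/negP => /andP[sl sr].
have /set0Pn[u ul] := scope_neq0 wfr (ltn_trans mlm mlt).
have /set0Pn[w wr] := scope_neq0 wfr (ltn_trans mrm mlt).
move: (subsetP sl _ ul) (subsetP sr _ wr) (wr); rewrite !inE => /eqP uv /eqP ->.
by rewrite -uv (disjointFr dis ul).
Qed.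

Lemma scope_lit_lit n v b m v' b' :
  onth pc n = Some (Lit v b) -> onth rc m = Some (Lit v' b') ->
  scope rc m \subset scope pc n = (v' == v).
Proof. by move=> gn gm; rewrite (scopeE wfp gn) (scopeE wfr gm) /= sub1set inE. Qed.

End Moments.

(** * Running time of programs *)

(* iw, rw, iaw and raw list the index registers, number registers, index arrays and
   number arrays that a command may write. *)
Fixpoint iw c : seq nat :=
  match c with
  | Instr (IConst r _) | Instr (IAdd r _ _) | Instr (ISub r _ _)
  | Instr (ILoad r _ _) => [:: r]
  | Instr _ => [::]
  | Seq c1 c2 | IfLt _ _ c1 c2 => iw c1 ++ iw c2
  | WhileLt _ _ c => iw c
  end.

Fixpoint rw c : seq nat :=
  match c with
  | Instr (RConst r _) | Instr (RAdd r _ _) | Instr (RSub r _ _)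
  | Instr (RMul r _ _) | Instr (RLoad r _ _) => [:: r]
  | Instr _ => [::]
  | Seq c1 c2 | IfLt _ _ c1 c2 => rw c1 ++ rw c2
  | WhileLt _ _ c => rw c
  end.

Fixpoint iaw c : seq nat :=
  match c with
  | Instr (IStore A _ _) => [:: A]
  | Instr _ => [::]
  | Seq c1 c2 | IfLt _ _ c1 c2 => iaw c1 ++ iaw c2
  | WhileLt _ _ c => iaw c
  end.

Fixpoint raw c : seq nat :=
  match c with
  | Instr (RStore A _ _) => [:: A]
  | Instr _ => [::]
  | Seq c1 c2 | IfLt _ _ c1 c2 => raw c1 ++ raw c2
  | WhileLt _ _ c => raw c
  end.

(** There is no idle instruction; register 41 serves only this purpose. *)
Definition skip := Instr (IConst 41 0).

Fixpoint blk (l : seq instr) (c : cmd) : cmd :=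
  if l is o :: l' then Seq (Instr o) (blk l' c) else c.

(* Register 3 holds 1. *)
Definition For r b body :=
  Seq (Instr (IConst r 0)) (WhileLt r b (Seq body (Instr (IAdd r r 3)))).

Section Run.
Variable R : realFieldType.
Implicit Types (c : cmd) (s : state R) (Q : state R -> Prop).

(** The frame of a command. The lists of written locations compute, so [isT] proves that a given
    register or array is untouched. *)
Record same c s s' : Prop := Same {
  same_i : forall r, r \notin iw c -> ireg s' r = ireg s r;
  same_r : forall r, r \notin rw c -> rreg s' r = rreg s r;
  same_ia : forall A, A \notin iaw c -> iarr s' A = iarr s A;
  same_ra : forall A, A \notin raw c -> rarr s' A = rarr s A }.

Lemma same_trans c s1 s2 s3 : same c s1 s2 -> same c s2 s3 -> same c s1 s3.
Proof.
by move=> [a b e f] [a' b' e' f']; split=> r rc; rewrite ?a' ?b' ?e' ?f' ?a ?b ?e ?f.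
Qed.

Lemma same_sub c c' s s' : {subset iw c <= iw c'} -> {subset rw c <= rw c'} ->
  {subset iaw c <= iaw c'} -> {subset raw c <= raw c'} -> same c s s' -> same c' s s'.
Proof.
move=> si sr sia sra [a b e f]; split=> r nr; [apply: a|apply: b|apply: e|apply: f];
  apply: contra nr; [apply: si|apply: sr|apply: sia|apply: sra].
Qed.

Lemma exec_same c s T s' : exec c s T s' -> same c s s'.
Proof.
elim=> {c s T s'} [o s|c1 c2 s t1 s1 t2 s2 _ IH1 _ IH2|a b c1 c2 s t s' _ _ IH
  |a b c1 c2 s t s' _ _ IH|a b c s t1 s1 t2 s2 _ _ IH1 _ IH2|//] //.
- by case: o => *; split=> //= r; rewrite /upd ?inE // => /negbTE ->.
- apply: same_trans (same_sub _ _ _ _ IH1) (same_sub _ _ _ _ IH2);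
    by move=> r; rewrite mem_cat => ->; rewrite ?orbT.
- by apply: (same_sub _ _ _ _ IH) => r; rewrite mem_cat => ->.
- by apply: (same_sub _ _ _ _ IH) => r; rewrite mem_cat => ->; rewrite orbT.
by apply: same_trans IH2; apply: (same_sub _ _ _ _ IH1).
Qed.

Definition runs c s T Q : Prop := exists t s', [/\ exec c s t s', t <= T & Q s'].

Lemma runs_instr o c s T Q : 0 < T ->
  runs c (exec_instr o s) (T - 1) Q -> runs (Seq (Instr o) c) s T Q.
Proof.
move=> T0 [t [s' [e le q]]]; exists (1 + t), s'; split=> //; last by lia.
by apply: ExecSeq e; apply: ExecInstr.
Qed.

Lemma runs_instr1 o s T Q : 0 < T -> Q (exec_instr o s) -> runs (Instr o) s T Q.
Proof. by move=> T0 q; exists 1, (exec_instr o s); split=> //; apply: ExecInstr. Qed.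

Lemma runs_call c1 c2 s t1 T Q1 Q : runs c1 s t1 Q1 -> t1 <= T ->
  (forall s1, same c1 s s1 -> Q1 s1 -> runs c2 s1 (T - t1) Q) ->
  runs (Seq c1 c2) s T Q.
Proof.
move=> [t [s1 [e le q]]] tT /(_ s1 (exec_same e) q)[t' [s2 [e' le' q']]].
by exists (t + t'), s2; split=> //; [apply: ExecSeq e e'|lia].
Qed.

Lemma runs_last c s t1 T Q1 Q : runs c s t1 Q1 -> t1 <= T ->
  (forall s1, same c s s1 -> Q1 s1 -> Q s1) -> runs c s T Q.
Proof.
move=> [t [s1 [e le q]]] tT /(_ s1 (exec_same e) q) q'.
by exists t, s1; split=> //; lia.
Qed.

Lemma runs_if a b c1 c2 s T Q : 0 < T ->
  (ireg s a < ireg s b -> runs c1 s (T - 1) Q) ->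
  (ireg s b <= ireg s a -> runs c2 s (T - 1) Q) -> runs (IfLt a b c1 c2) s T Q.
Proof.
move=> T0 H1 H2; have [le|lt] := leqP (ireg s b) (ireg s a).
  have [t [s' [e tT q]]] := H2 le; exists t.+1, s'; split=> //; last by lia.
  exact: ExecIfFalse.
have [t [s' [e tT q]]] := H1 lt; exists t.+1, s'; split=> //; last by lia.
exact: ExecIfTrue.
Qed.

(** A round pays its body, one test and one increment; the leading 2 is the initialisation and the
    failing test. [I j] speaks of the state in which the counter already holds [j]. Bounds varying
    with the round serve the loops whose cost depends on degrees. *)
Lemma runs_for r b body s n (tb : nat -> nat) (I : nat -> state R -> Prop) T Q :
  ireg s b = n -> ireg s 3 = 1 ->
  (r \notin iw body) && (b \notin r :: iw body) && (3 \notin r :: iw body) ->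
  I 0 (set_ireg s r 0) ->
  (forall j s', j < n -> same (For r b body) s s' -> ireg s' r = j -> I j s' ->
     runs body s' (tb j) (fun s'' => I j.+1 (set_ireg s'' r j.+1))) ->
  2 + \sum_(j < n) (2 + tb j) <= T ->
  (forall s', same (For r b body) s s' -> I n s' -> Q s') ->
  runs (For r b body) s T Q.
Proof.
move=> bn one /andP[/andP[rb bb] oneb] I0 Istep TT IQ.
set w := WhileLt r b (Seq body (Instr (IAdd r r 3))).
have wsub s1 s2 : same w s1 s2 -> same (For r b body) s1 s2.
  by apply: same_sub => // x xw; rewrite inE xw orbT.
have notw x : x \notin r :: iw body -> x \notin iw (For r b body).
  by rewrite /= !inE mem_cat !inE !negb_or => /andP[-> ->].
have loop l : forall j s', j + l = n -> same (For r b body) s s' -> ireg s' r = j ->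
    I j s' -> runs w s' (1 + \sum_(j <= i < n) (2 + tb i)) (I n).
  elim: l => [|l IH] j s' jl sm rj Ij.
    move: jl; rewrite addn0 => jn; rewrite -jn.
    exists 1, s'; split=> //; apply: ExecWhileFalse.
    by rewrite (same_i sm) ?notw // bn rj jn.
  have jn : j < n by lia.
  have [t1 [s1 [e1 le1 I1]]] := Istep _ _ jn sm rj Ij.
  have sm1 : same (For r b body) s s1.
    apply: same_trans sm (wsub _ _ _).
    by apply: same_sub (exec_same e1) => //= x; rewrite ?mem_cat => ->.
  have incr : set_ireg s1 r j.+1 = exec_instr (IAdd r r 3) s1.
    rewrite /= (same_i sm1 (notw _ oneb)) one (same_i (exec_same e1)) // rj.
    by rewrite addn1.
  have e2 := ExecSeq e1 (ExecInstr (IAdd r r 3) s1); rewrite -incr in e2.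
  have [||||t2 [s2 [e3 le3 I2]]] := IH j.+1 (set_ireg s1 r j.+1) => //.
  - by rewrite addSnnS.
  - apply: same_trans sm (wsub _ _ _).
    by apply: same_sub (exec_same e2).
  - by rewrite /= /upd eqxx.
  exists (t1 + 1 + t2).+1, s2; split=> //.
    apply: ExecWhileTrue e2 e3.
    by have := same_i sm (notw _ bb); rewrite bn rj => ->.
  by rewrite big_ltn //; lia.
have s0 : same (For r b body) s (set_ireg s r 0).
  by apply: same_sub (exec_same (ExecInstr (IConst r 0) s)) => // x; rewrite !inE => ->.
have [||||t [s2 [e le q]]] := loop n 0 (set_ireg s r 0) => //.
  by rewrite /= /upd eqxx.
exists (1 + t), s2; split; last apply: IQ => //.
- by apply: ExecSeq e; apply: ExecInstr.
- by move: le; rewrite big_mkord; lia.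
exact: same_trans s0 (wsub _ _ (exec_same e)).
Qed.

Lemma runs_forc r b body s n t (I : nat -> state R -> Prop) T Q :
  ireg s b = n -> ireg s 3 = 1 ->
  (r \notin iw body) && (b \notin r :: iw body) && (3 \notin r :: iw body) ->
  I 0 (set_ireg s r 0) ->
  (forall j s', j < n -> same (For r b body) s s' -> ireg s' r = j -> I j s' ->
     runs body s' t (fun s'' => I j.+1 (set_ireg s'' r j.+1))) ->
  2 + n * (2 + t) <= T ->
  (forall s', same (For r b body) s s' -> I n s' -> Q s') ->
  runs (For r b body) s T Q.
Proof.
move=> bn one nw I0 Istep TT; apply: (runs_for bn one nw I0 Istep).
by rewrite sum_nat_const card_ord.
Qed.

(** [Nat.eqb] rather than [==] lets [cbn] decide comparisons of literal register numbers. *)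
Lemma iregI s r v r' :
  ireg (set_ireg s r v) r' = if Nat.eqb r' r then v else ireg s r'.
Proof. by []. Qed.
Lemma iregR s r v : ireg (set_rreg s r v) = ireg s. Proof. by []. Qed.
Lemma iregIA s A i v : ireg (set_iarr s A i v) = ireg s. Proof. by []. Qed.
Lemma iregRA s A i v : ireg (set_rarr s A i v) = ireg s. Proof. by []. Qed.
Lemma rregR s r v r' :
  rreg (set_rreg s r v) r' = if Nat.eqb r' r then v else rreg s r'.
Proof. by []. Qed.
Lemma rregI s r v : rreg (set_ireg s r v) = rreg s. Proof. by []. Qed.
Lemma rregIA s A i v : rreg (set_iarr s A i v) = rreg s. Proof. by []. Qed.
Lemma rregRA s A i v : rreg (set_rarr s A i v) = rreg s. Proof. by []. Qed.
Lemma iarrIA s A i v A' p : iarr (set_iarr s A i v) A' p =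
  if Nat.eqb A' A then (if p == i then v else iarr s A p) else iarr s A' p.
Proof. by rewrite /= /upd (_ : Nat.eqb A' A = (A' == A)) //; case: eqP. Qed.
Lemma iarrI s r v : iarr (set_ireg s r v) = iarr s. Proof. by []. Qed.
Lemma iarrR s r v : iarr (set_rreg s r v) = iarr s. Proof. by []. Qed.
Lemma iarrRA s A i v : iarr (set_rarr s A i v) = iarr s. Proof. by []. Qed.
Lemma rarrRA s A i v A' p : rarr (set_rarr s A i v) A' p =
  if Nat.eqb A' A then (if p == i then v else rarr s A p) else rarr s A' p.
Proof. by rewrite /= /upd (_ : Nat.eqb A' A = (A' == A)) //; case: eqP. Qed.
Lemma rarrI s r v : rarr (set_ireg s r v) = rarr s. Proof. by []. Qed.
Lemma rarrR s r v : rarr (set_rreg s r v) = rarr s. Proof. by []. Qed.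
Lemma rarrIA s A i v : rarr (set_iarr s A i v) = rarr s. Proof. by []. Qed.

Definition stE := (iregI, iregR, iregIA, iregRA, rregR, rregI, rregIA, rregRA,
  iarrIA, iarrI, iarrR, iarrRA, rarrRA, rarrI, rarrR, rarrIA).

End Run.


Ltac sx := cbn [exec_instr]; rewrite ?stE; cbn [Nat.eqb].
(* Time bounds only depend on the inequalities of the context, whereas lia splits
   cases on its disequalities and Boolean equations. *)
Ltac budget := repeat match goal with
  | H : ?P |- _ => match type of P with Prop =>
      match P with is_true (leq _ _) => fail 1 | _ => clear H end end
  end; lia.
Ltac step := cbn [blk]; apply: runs_instr; [budget | sx].
Ltac fin := cbn [blk]; apply: runs_instr1; [budget | sx].
(* Rewrites the reads of a state to those of the state it was reached from. *)
Ltac fr := sx; repeat (match goal with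
  | sm : same _ _ ?s |- context [ireg ?s ?r] => rewrite (@same_i _ _ _ _ sm r isT)
  | sm : same _ _ ?s |- context [rreg ?s ?r] => rewrite (@same_r _ _ _ _ sm r isT)
  | sm : same _ _ ?s |- context [iarr ?s ?A] => rewrite (@same_ia _ _ _ _ sm A isT)
  | sm : same _ _ ?s |- context [rarr ?s ?A] => rewrite (@same_ra _ _ _ _ sm A isT)
  end; sx).

(** * Binomial convolution of rows *)

Section Prog.
Import GRing.Theory.
Variables (R : realFieldType) (k : nat).
Implicit Types (s : state R) (Q : state R -> Prop).
Local Notation K := k.+1.

Opaque set_ireg set_rreg set_iarr set_rarr.

Definition trow s q i : R := rarr s 2 (q * K + i).

Lemma trow_eq q i q' i' : i < K -> i' < K ->
  (q * K + i == q' * K + i') = (q == q') && (i == i').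
Proof.
move=> iK i'K; apply/eqP/andP => [E|[/eqP -> /eqP ->]//].
have := congr1 (divn^~ K) E; have := congr1 (modn^~ K) E.
rewrite !modnMDl !divnMDl // !divn_small // !modn_small // !addn0.
by move=> -> ->.
Qed.

Definition binok s : Prop :=
  forall i a, i < K -> a < K -> rarr s 3 (i * K + a) = ('C(i, a)%:R)%R.

Lemma trow_set s q p i j v : i < K -> j < K ->
  trow (set_rarr s 2 (q * K + i) v) p j = if (p == q) && (j == i) then v else trow s p j.
Proof. by move=> iK jK; rewrite /trow stE /= trow_eq. Qed.

(** The moments of a sum of independent variables whose moments are [f] and [g]. *)
Definition convol (f g : nat -> R) i : R :=
  (\sum_(a < i.+1) 'C(i, a)%:R * f a * g (i - a)%N)%R.

(** Registers 14 and 15 hold [i] and [a], and 17 the start of row [i] of Pascal's triangle; 11, 12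
    and 13 hold the starts of the two source rows and of the target row. *)
Definition conv_term :=
  blk [:: IAdd 18 17 15; RLoad 2 3 18; IAdd 18 11 15; RLoad 3 2 18;
          ISub 18 14 15; IAdd 18 12 18; RLoad 4 2 18;
          RMul 2 2 3; RMul 2 2 4] (Instr (RAdd 1 1 2)).

Definition conv_entry :=
  blk [:: RConst 1 false; IAdd 16 14 3] (Seq (For 15 16 conv_term)
    (blk [:: IAdd 18 13 14; RLoad 2 2 18; RAdd 2 2 1; RStore 2 18 2]
         (Instr (IAdd 17 17 4)))).

Definition conv := Seq (Instr (IConst 17 0)) (For 14 4 conv_entry).

Lemma conv_spec s qx qy qz :
  ireg s 3 = 1 -> ireg s 4 = K -> ireg s 11 = qx * K ->
  ireg s 12 = qy * K -> ireg s 13 = qz * K ->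
  qx != qz -> qy != qz -> binok s ->
  runs conv s (40 * K * K) (fun s' => forall q i, i < K ->
    trow s' q i = if q == qz then (trow s qz i + convol (trow s qx) (trow s qy) i)%R
                 else trow s q i).
Proof.
move=> s3 s4 s11 s12 s13 xz yz bin.
have KK : K <= K * K by rewrite leq_pmulr.
set new := fun i => (trow s qz i + convol (trow s qx) (trow s qy) i)%R.
rewrite /conv; step.
pose I i s' := ireg s' 17 = i * K /\
  forall q j, j < K -> trow s' q j = if (q == qz) && (j < i) then new j else trow s q j.
apply: (runs_forc (n := K) (t := 30 * K) (I := I)); rewrite ?stE //=; last 2 first.
- lia.
- by move=> s' _ [_ rows] q i iK; rewrite rows // iK andbT; case: eqP => // ->.
- by split=> // q j jK; rewrite ltn0 andbF /trow stE.
move=> i s' iK sm ii [rb rows]; rewrite /conv_entry; do 2 step.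
pose J a s2 := rreg s2 1 = (\sum_(b < a) 'C(i, b)%:R * trow s qx b * trow s qy (i - b)%N)%R.
apply: (@runs_call _ _ _ _ (22 * K) _ (J i.+1)); [|lia|].
  apply: (runs_forc (n := i.+1) (t := 10) (I := J)) => //.
  - by fr; rewrite ii s3 addn1.
  - by fr.
  - by rewrite /J stE /= big_ord0.
  - move=> a s2 ai sm2 aa Ja; rewrite /conv_term; do 9 step; fin; rewrite /J; fr.
    have aK : a < K by lia.
    rewrite aa rb s11 s12 ii bin // -/(trow s' qx a) -/(trow s' qy (i - a)).
    rewrite !rows ?(negbTE xz) ?(negbTE yz) /=; [|lia|lia].
    by rewrite Ja big_ord_recr.
  - by lia.
move=> s2 sm2 J2; do 4 step; fin; fr; rewrite ?rb ?s4 ?s13 ?ii.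
split; fr; first lia.
move=> q j jK; rewrite /trow; fr; rewrite trow_eq // -/(trow s' qz i) -/(trow s' q j) !rows //.
rewrite eqxx ltnn /= J2 ltnS (leq_eqVlt j); case: (q =P qz) => // ->.
by case: (j =P i) => //= ->.
Qed.

(** The moments of a mass theta placed at psi. Multiplying by 1 stands for a move between number
    registers. *)
Definition geo :=
  blk [:: RConst 7 true; RMul 7 7 5] (For 14 4
    (blk [:: RStore 2 14 7] (Instr (RMul 7 7 6)))).

Lemma geo_spec s : ireg s 3 = 1 -> ireg s 4 = K ->
  runs geo s (10 * K) (fun s' => forall q i, i < K ->
    trow s' q i = if q == 0 then (rreg s 5 * rreg s 6 ^+ i)%R else trow s q i).
Proof.
move=> s3 s4; rewrite /geo; do 2 step.
pose I i s' := rreg s' 7 = (rreg s 5 * rreg s 6 ^+ i)%R /\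
  forall q j, j < K -> trow s' q j =
    if (q == 0) && (j < i) then (rreg s 5 * rreg s 6 ^+ j)%R else trow s q j.
apply: (runs_forc (n := K) (t := 2) (I := I)); rewrite ?stE //=; last 2 first.
- lia.
- by move=> s' _ [_ rows] q i iK; rewrite rows // iK andbT.
- by split=> [|q j jK]; rewrite /trow ?ltn0 ?andbF stE /= ?expr0 ?mulr1 ?mul1r.
move=> i s' iK sm ii [pw rows]; step; fin; split; fr; rewrite pw.
  by rewrite exprSr mulrA.
move=> q j jK; rewrite /trow; fr; rewrite ii -[i in _ == i]/(0 * K + i) trow_eq // -/(trow s' q j).
rewrite rows // ltnS (leq_eqVlt j); case: (q =P 0) => // ->.
by case: (j =P i) => //= ->.
Qed.

(* Row 0 is scratch space; adds theta times the moments of psi + g to a row, where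
   theta and psi are in registers 5 and 6 and the source row holds those of g. *)
Definition accum := Seq geo (Seq (Instr (IConst 12 0)) conv).

Lemma accum_spec s qx qz :
  ireg s 3 = 1 -> ireg s 4 = K -> ireg s 11 = qx * K -> ireg s 13 = qz * K ->
  qx != 0 -> qz != 0 -> qx != qz -> binok s ->
  runs accum s (60 * K * K) (fun s' => forall q i, i < K -> q != 0 ->
    trow s' q i = if q == qz then
        (trow s qz i + convol (trow s qx) (fun j => rreg s 5 * rreg s 6 ^+ j) i)%R
      else trow s q i).
Proof.
move=> s3 s4 s11 s13 x0 z0 xz bin.
have KK : K <= K * K by rewrite leq_pmulr.
apply: (runs_call (geo_spec s3 s4)); first lia.
move=> s1 sm1 r1; step.
apply: (runs_last (@conv_spec _ qx 0 qz _ _ _ _ _ _ _ _)); try by fr.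
- by rewrite eq_sym.
- by move=> i a iK aK; fr; apply: bin.
- lia.
move=> s2 _ r2 q i iK q0; rewrite r2 // /trow stE -/(trow s1 qz i) -/(trow s1 q i).
rewrite !r1 // (negbTE q0) (negbTE z0); case: eqP => // _; congr (_ + _)%R.
apply: eq_bigr => a _; have ai := ltn_ord a.
rewrite -/(trow s1 qx a) -/(trow s1 0 (i - a)) !r1; [|lia|lia].
by rewrite (negbTE x0).
Qed.

(** As [0 ^+ 0 = 1], only the term [a = i] survives: with psi = 0, [accum] adds theta times a
    row. *)
Lemma convol_geo0 (f : nat -> R) c i : convol f (fun j => c * 0 ^+ j)%R i = (c * f i)%R.
Proof.
rewrite /convol big_ord_recr /= subnn expr0 binn mul1r mulr1 mulrC.
rewrite big1 ?add0r // => a _; have [j ->] : exists j, i - a = j.+1.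
  by exists (i - a).-1; have := ltn_ord a; lia.
by rewrite exprS mul0r !mulr0.
Qed.

End Prog.

(** * Dynamic programming over pairs of nodes *)

(* Registers 0 to 2 hold k and the sizes of the circuits, 3 to 5 hold 1, k + 1 and 0,
   and 20 holds 2 * (k + 1).  Registers 6 and 7 hold the current pair of nodes (n, m),
   10 and 28 the addresses of its two rows of moments, and 22 to 27 its tags and
   fields.  Number array 2 is the table of moments, in rows of length k + 1, and
   number array 3 is Pascal's triangle.  The first row of (n, m) starts at the sum of
   the entry n of index array 8 and of the entry m of index array 9; at this address,
   index array 10 tells whether scope m is included in scope n. *)
Definition rc_or_input :=
  blk [:: IAdd 30 26 29; ILoad 31 7 30; ILoad 31 9 31; IAdd 11 8 31;
          RConst 5 true; RLoad 6 1 30; ILoad 32 10 11; IStore 10 10 32; IAdd 13 10 5]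
    accum.

(** By [W_false_or] the row without indicator is the row with it, except for a 1 at entry 0. Copying
    means adding to zeros, with theta = 1 and psi = 0. *)
Definition rc_or_case :=
  Seq (For 29 27 rc_or_input)
    (blk [:: RConst 5 true; RConst 6 false; IAdd 11 10 5; IAdd 13 28 5]
      (Seq accum (blk [:: RConst 2 true] (Instr (RStore 2 28 2))))).

(** The two rows of a pair are adjacent, so adding register 4 to the start of the first gives the
    second. *)
Definition accum_pair := Seq accum (blk [:: IAdd 11 11 4; IAdd 13 28 5] accum).

Definition pc_or_input :=
  blk [:: IAdd 30 24 29; ILoad 31 3 30; ILoad 31 8 31; IAdd 11 31 9;
          RLoad 5 0 30; RConst 6 false; ILoad 32 10 11; IStore 10 10 32; IAdd 13 10 5]
    accum_pair.

Definition pc_or_case := For 29 25 pc_or_input.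

Definition copy r :=
  blk [:: RConst 5 true; RConst 6 false; IStore 10 10 3; IAdd 11 r 5; IAdd 13 10 5]
    accum_pair.

Definition conv_pair :=
  Seq conv (blk [:: IAdd 11 11 4; IAdd 12 12 4; IAdd 13 28 5] conv).

(* The truncated difference 37 + 38 - 1 is the conjunction of two flags. *)
Definition and_and_case :=
  blk [:: ILoad 39 9 26; IAdd 11 33 39; ILoad 39 9 27; IAdd 12 34 39;
          ILoad 37 10 11; ILoad 38 10 12; IAdd 37 37 38; ISub 37 37 3;
          IStore 10 10 37; IAdd 13 10 5]
    conv_pair.

Definition pc_and_case :=
  blk [:: ILoad 33 8 24; ILoad 34 8 25; IAdd 35 33 9; IAdd 36 34 9;
          ILoad 37 10 35; ILoad 38 10 36]
    (IfLt 5 37 (copy 35) (IfLt 5 38 (copy 36) (IfLt 5 23 and_and_case skip))).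

(** Strict tests in both directions decide equality, of the variables and then of the signs. For
    equal variables the zeroth moment without indicator is 1 whatever the signs; the one with
    indicator is 1 only if they agree. *)
Definition pc_lit_case :=
  IfLt 5 23 skip (IfLt 24 26 skip (IfLt 26 24 skip
    (blk [:: IStore 10 10 3; RConst 2 true; RStore 2 28 2]
      (IfLt 25 27 skip (IfLt 27 25 skip (Instr (RStore 2 10 2))))))).

(** The recurrence at an OR gate of the RC holds whatever [n] is, and the one at an OR gate of the
    PC whatever [m] is, so only AND gates and literals reach the last two cases. *)
Definition pair_case :=
  IfLt 3 23 rc_or_case (IfLt 3 22 pc_or_case (IfLt 5 22 pc_and_case pc_lit_case)).

Definition pair_load : seq instr :=
  [:: ILoad 22 0 6; ILoad 23 4 7; ILoad 24 1 6; ILoad 25 2 6; ILoad 26 5 7;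
      ILoad 27 6 7; ILoad 8 8 6; ILoad 9 9 7; IAdd 28 10 4].

Definition deg d (R : Type) (c : circuit d R) i : nat :=
  if onth c i is Some g then size (children g) else 0.

Lemma deg_sum d (R : Type) (c : circuit d R) :
  \sum_(i < size c) deg c i = num_edges c.
Proof.
rewrite /num_edges; elim: c => [|g c IH]; first by rewrite big_ord0 big_nil.
by rewrite big_ord_recl big_cons /= -IH.
Qed.

Lemma or_slice d (R : realFieldType) (c : circuit d R) i ch j :
  onth c i = Some (Or ch) -> j < size ch ->
  nth (0, 0%R) (all_or_inputs c) (size (all_or_inputs (take i c)) + j) = nth (0, 0%R) ch j.
Proof.
move=> gi jch; have [c1 [c2 [-> ->]]] : exists c1 c2, c = c1 ++ Or ch :: c2 /\ i = size c1.
  elim: c i gi => [|g c IH] [|i] //= => [[->]|/IH[c1 [c2 [-> ->]]]].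
    by exists [::], c.
  by exists (g :: c1), c2.
rewrite take_size_cat // /all_or_inputs map_cat flatten_cat /=.
by rewrite nth_cat ltnNge leq_addr addKn nth_cat jch.
Qed.

Definition binom_entry :=
  blk [:: IAdd 19 17 15; RLoad 2 3 19; IAdd 19 19 3; RLoad 3 3 19; RAdd 2 2 3;
          IAdd 19 18 15; IAdd 19 19 3] (Instr (RStore 3 19 2)).

Definition binom_row :=
  blk [:: IAdd 18 17 4; RConst 1 true; RStore 3 18 1]
    (Seq (For 15 0 binom_entry) (Instr (IAdd 17 18 5))).

(** Memory starts at 0, so the first row of Pascal's triangle only needs its entry 0. *)
Definition binom_table :=
  blk [:: IConst 17 0; RConst 1 true; RStore 3 17 1] (For 14 0 binom_row).

(** Index registers can only be added and subtracted, so multiples of the stride in register 20 are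
    tabulated by repeated addition. *)
Definition col_table :=
  Seq (Instr (IConst 21 0)) (For 7 2 (blk [:: IStore 9 7 21] (Instr (IAdd 21 21 20)))).

Definition pair_step := blk pair_load (Seq pair_case (Instr (IAdd 10 10 20))).

Definition pair_row := blk [:: IStore 8 6 10] (For 7 2 pair_step).

Definition moment_program :=
  blk [:: IConst 3 1; IAdd 4 0 3; IAdd 20 4 4]
    (Seq binom_table (Seq col_table (blk [:: IAdd 10 4 5]
      (Seq (For 6 1 pair_row) (blk [:: ISub 18 10 3] (Instr (RLoad 0 2 18))))))).

(** * Invariants of the table of moments *)

Section Pairs.
Import GRing.Theory.
Variables (d : nat) (R : realFieldType) (t : vtree d) (pc rc : circuit d R) (k : nat).
Hypotheses (wft : wf_vtree t) (PC : is_PC t pc) (RC : is_RC t rc).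
Implicit Types (s : state R) (Q : state R -> Prop).
Local Notation K := k.+1.
Local Notation Vr := (size rc).
Local Notation Vp := (size pc).
Local Notation W := (W pc rc).
Local Notation trow := (trow k).

Opaque set_ireg set_rreg set_iarr set_rarr.

Definition flag s q : nat := iarr s 10 (q * K).

(* Rows q1 p and q0 p hold the moments of the pair of index p, with and without the
   indicator. *)
Definition q1 p := 2 * p + 1.
Definition q0 p := 2 * p + 2.
Definition pid n m := n * Vr + m.

Record env s : Prop := Env {
  e1 : ireg s 1 = Vp; e2 : ireg s 2 = Vr; e3 : ireg s 3 = 1; e4 : ireg s 4 = K;
  e5 : ireg s 5 = 0; e20 : ireg s 20 = 2 * K;
  eia : forall A, A < 8 -> iarr s A = iarr (input k pc rc) A;
  era : forall A, A < 2 -> rarr s A = rarr (input k pc rc) A;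
  ebin : binok k s;
  ecol : forall m, m < Vr -> iarr s 9 m = m * (2 * K) }.

Definition env_safe c := [&& all (fun r => r \notin iw c) [:: 1; 2; 3; 4; 5; 20],
  all (fun A => A \notin iaw c) (9 :: iota 0 8) & all (fun A => A \notin raw c) [:: 0; 1; 3]].

Lemma env_same c s s' : env_safe c -> same c s s' -> env s -> env s'.
Proof.
case/and3P => /allP ci /allP cia /allP cra [si sr sia sra].
case=> a1 a2 a3 a4 a5 a20 aia ara abin acol; split; rewrite ?si ?ci //.
- by move=> A A8; rewrite sia ?aia //; apply: cia; rewrite inE mem_iota A8 orbT.
- by move=> A A2; rewrite sra ?ara //; apply: cra; case: A A2 => [|[]].
- by move=> i a iK aK; rewrite sra ?abin //; apply: cra.
by move=> m mV; rewrite sia ?acol //; apply: cia.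
Qed.

Definition sub n m := scope rc m \subset scope pc n.

(** [W] is an expectation under node [n] only if [m] depends on no variable outside the scope of
    [n]; the flag has to be right for every pair. *)
Definition good s n m : Prop :=
  flag s (q1 (pid n m)) = sub n m /\
  (sub n m -> forall i, i < K ->
    trow s (q1 (pid n m)) i = W true n m i /\ trow s (q0 (pid n m)) i = W false n m i).

Definition keeps p s s' : Prop :=
  (forall q i, i < K -> q \notin [:: 0; q1 p; q0 p] -> trow s' q i = trow s q i) /\
  (forall q, q != q1 p -> flag s' q = flag s q).

(** By [p_0] and [p_S0] the memory ahead is still zero: rows can be accumulated into, and an
    untouched flag records that inclusion fails. *)
Record pre n m s : Prop := Pre {
  p_env : env s;
  p_n : n < Vp; p_m : m < Vr;
  p10 : ireg s 10 = q1 (pid n m) * K;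
  p28 : ireg s 28 = q0 (pid n m) * K;
  p8 : ireg s 8 = q1 (n * Vr) * K;
  p9 : ireg s 9 = m * (2 * K);
  p22 : ireg s 22 = gate_tag pc n;
  p23 : ireg s 23 = gate_tag rc m;
  p24 : ireg s 24 = field1 pc n;
  p25 : ireg s 25 = field2 pc n;
  p26 : ireg s 26 = field1 rc m;
  p27 : ireg s 27 = field2 rc m;
  p_row : forall n', n' <= n -> iarr s 8 n' = q1 (n' * Vr) * K;
  p_good : forall n' m', n' < Vp -> m' < Vr -> pid n' m' < pid n m -> good s n' m';
  p_0 : forall q i, i < K -> q1 (pid n m) <= q -> trow s q i = 0%R;
  p_S0 : flag s (q1 (pid n m)) = 0 }.

Definition post n m s s' := good s' n m /\ keeps (pid n m) s s'.

Lemma base_q1 n m : q1 (n * Vr) * K + m * (2 * K) = q1 (pid n m) * K.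
Proof. by rewrite /q1 /pid; nia. Qed.

Lemma base_q0 p : q1 p * K + K = q0 p * K.
Proof. by rewrite /q1 /q0; nia. Qed.

Lemma convol_eq (f f' g g' : nat -> R) i : (forall j, j <= i -> f j = f' j) ->
  (forall j, j <= i -> g j = g' j) -> convol f g i = convol f' g' i.
Proof.
move=> ff gg; apply: eq_bigr => a _; have ai := ltn_ord a.
by rewrite ff ?gg //; lia.
Qed.

(** With [n] outermost, a recurrence looks up either the same [n] with a smaller [m], or a smaller
    [n] with any node of the RC. *)
Lemma pid_lt_r n m m' : m' < m -> pid n m' < pid n m.
Proof. by rewrite /pid; lia. Qed.

Lemma pid_lt_l n n' m m' : n' < n -> m' < Vr -> pid n' m' < pid n m.
Proof. by rewrite /pid => nn mV; nia. Qed.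


(** * Correctness of the cases for a pair of gates *)

Lemma rc_or_child m ch j : onth rc m = Some (Or ch) -> j < size ch ->
  [/\ (nth (0, 0%R) ch j).1 \in map fst ch,
      or_child rc (field1 rc m + j) = (nth (0, 0%R) ch j).1
    & or_param rc (field1 rc m + j) = (nth (0, 0%R) ch j).2].
Proof.
move=> gm jch; rewrite /or_child /or_param /field1 gm (or_slice gm jch).
by split=> //; apply: map_f; apply: mem_nth.
Qed.

Lemma rc_or_spec n m s ch : pre n m s -> onth rc m = Some (Or ch) ->
  runs rc_or_case s (200 * K * K * (1 + size ch)) (post n m s).
Proof.
move=> pr gm; have [wfr smr _ _] := RC; have [wfp _ _ _ _] := PC.
have en := p_env pr; have nV := p_n pr; have mV := p_m pr.
set p := pid n m.
have KK : 0 < K * K by [].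
have KKs : size ch <= size ch * (K * K) by rewrite leq_pmulr.
(* Each round copies the flag of an input, always the same by smoothness. It is known only after one
   round, which takes place since an OR gate has an input. *)
pose I j s' := [/\ 0 < j -> flag s' (q1 p) = sub n m,
   sub n m -> forall i, i < K -> trow s' (q1 p) i =
     (\sum_(e <- take j ch) convol (W true n e.1) (fun a => e.2 ^+ a) i)%R,
   forall q i, i < K -> q != 0 -> q != q1 p -> trow s' q i = trow s q i
   & forall q, q != q1 p -> flag s' q = flag s q].
rewrite /rc_or_case.
apply: (@runs_call _ _ _ _ ((70 * K * K + 20) * size ch + 2) _ (I (size ch))); [|lia|].
  apply: (runs_forc (n := size ch) (t := 60 * K * K + 12) (I := I)) => //.
  - by rewrite (p27 pr) /field2 gm.
  - exact: e3 en.
  - split=> // _ i iK; rewrite /trow stE take0 big_nil.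
    by rewrite -/(trow s (q1 p) i) (p_0 pr).
  - move=> j s' jn sm jj [I1 I2 I3 I4]; rewrite /rc_or_input.
    have [ech ec ep] := rc_or_child gm jn; set e := nth (0, 0%R) ch j in ech ec ep.
    have em := child_lt wfr gm ech.
    do 9 step.
    have r30 : ireg s' 26 + ireg s' 29 = field1 rc m + j by fr; rewrite jj (p26 pr).
    have i7 : iarr s' 7 (field1 rc m + j) = e.1 by fr; rewrite (eia en).
    have i9 : iarr s' 9 e.1 = e.1 * (2 * K) by fr; rewrite (ecol en) //; lia.
    have r11 : ireg s' 8 + e.1 * (2 * K) = q1 (pid n e.1) * K by fr; rewrite (p8 pr) base_q1.
    have i1 : rarr s' 1 (field1 rc m + j) = e.2 by fr; rewrite (era en).
    rewrite !(r30, i7, i9, r11, i1).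
    have r10 : ireg s' 10 = q1 p * K by fr; rewrite (p10 pr).
    have r5 : ireg s' 5 = 0 by fr; rewrite (e5 en).
    rewrite !r10 !r5 addn0.
    have pep : pid n e.1 < p by apply: pid_lt_r.
    have eV : e.1 < Vr by lia.
    have [gS gT] := p_good pr nV eV pep.
    have subE : sub n e.1 = sub n m by rewrite /sub (scope_or wfr smr gm ech).
    have q1e : q1 (pid n e.1) != q1 p by rewrite /q1; lia.
    have q1e0 : q1 (pid n e.1) != 0 by rewrite /q1; lia.
    apply: (runs_last (@accum_spec R k _ (q1 (pid n e.1)) (q1 p) _ _ _ _ _ _ _ _)).
    all: try by fr; rewrite ?(e3 en) ?(e4 en).
    all: try by rewrite /q1; lia.
    - by move=> i a iK aK; fr; apply: (ebin en).
    move=> s2 sm2 r2; split.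
    - by move=> _; rewrite /flag; fr; rewrite eqxx -/(flag s' _) I4 // gS subE.
    - move=> sb i iK; rewrite /trow; fr; rewrite -/(trow s2 _ _) r2 ?eqxx //; last by rewrite /q1; lia.
      rewrite (take_nth (0, 0%R) jn) -/e big_rcons /= -I2 // {1}/trow; fr.
      rewrite -/(trow s' _ _); congr (_ + _)%R; apply: convol_eq => a ai; last by fr; rewrite mul1r.
      have aK : a < K by lia.
      rewrite /trow; fr; rewrite -/(trow s' _ _) I3 //.
      by case: (gT _ a aK) => //; rewrite subE.
    - move=> q i iK q0 q1'; rewrite /trow; fr; rewrite -/(trow s2 _ _) r2 // (negbTE q1') /trow; fr.
      by rewrite -/(trow s' _ _) I3.
    - by move=> q q1'; rewrite /flag; fr; rewrite eqn_pmul2r // (negbTE q1') -/(flag s' q) I4.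
move=> s1 sm1 [S1 row1 oth1 S1'].
have ch0 : 0 < size ch by have := or_inputs_neq0 wfr gm; case: (ch).
have [r10 r28] : ireg s1 10 = q1 p * K /\ ireg s1 28 = q0 p * K.
  by split; fr; rewrite ?(p10 pr) ?(p28 pr).
have r5 : ireg s1 5 = 0 by fr; rewrite (e5 en).
do 4 step; rewrite !r10 !r28 !r5 !addn0.
have q10 : q1 p != q0 p by rewrite /q1 /q0; lia.
have q01 : q0 p != q1 p by rewrite eq_sym.
have q1le : q1 p <= q0 p by rewrite /q1 /q0; lia.
have q1n : q1 p != 0 by rewrite /q1; lia.
have q0n : q0 p != 0 by rewrite /q0; lia.
apply: (runs_call (@accum_spec R k _ (q1 p) (q0 p) _ _ _ _ _ _ _ _)) => //.
all: try by fr; rewrite ?(e3 en) ?(e4 en).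
all: try budget.
- by move=> i a iK aK; fr; apply: (ebin en).
move=> s2 sm2 r2; step; fin.
have row2 q i : i < K -> q != 0 -> trow s2 q i =
    if q == q0 p then trow s1 (q1 p) i else trow s1 q i.
  move=> iK q0'; rewrite r2 //; case: eqP => // _.
  rewrite /trow; fr; rewrite -!/(trow s1 _ _) oth1 ?(p_0 pr) //.
  rewrite add0r -[RHS]mul1r -convol_geo0; apply: convol_eq => a _; rewrite /trow; fr => //.
have s2_28 : ireg s2 28 = q0 p * K + 0 by fr; rewrite (p28 pr) addn0.
rewrite s2_28; split; last split.
- split; first by rewrite /flag; fr; rewrite -/(flag s1 _) S1.
  move=> sb i iK; rewrite !trow_set // !eqxx (negbTE q10) /=.
  rewrite /trow; fr; rewrite -!/(trow s2 _ _) !row2 // eqxx (negbTE q10) row1 // take_size.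
  rewrite (W_false_or wft PC RC _ nV gm) (W_rc_or pc RC _ _ gm); split=> //.
  by case: i iK.
- move=> q i iK; rewrite !inE !negb_or => /and3P[q0' q1' q2'].
  rewrite trow_set // (negbTE q2') /=; rewrite /trow; fr; rewrite -/(trow s2 _ _).
  by rewrite row2 // (negbTE q2') oth1.
by move=> q q1'; rewrite /flag; fr; rewrite -/(flag s1 _) S1'.
Qed.

Lemma accum_pair_spec s p' p :
  ireg s 3 = 1 -> ireg s 4 = K -> ireg s 5 = 0 -> ireg s 11 = q1 p' * K ->
  ireg s 13 = q1 p * K -> ireg s 28 = q0 p * K -> rreg s 6 = 0%R -> p' < p ->
  binok k s ->
  runs accum_pair s (125 * K * K) (fun s' => forall q i, i < K -> q != 0 ->
    trow s' q i = if q == q1 p then (trow s q i + rreg s 5 * trow s (q1 p') i)%R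
                  else if q == q0 p then (trow s q i + rreg s 5 * trow s (q0 p') i)%R
                  else trow s q i).
Proof.
move=> s3 s4 s5 s11 s13 s28 r6 pp bin.
have KK : 0 < K * K by [].
have q10 : q1 p != q0 p by rewrite /q1 /q0; lia.
have q01 : q0 p != q1 p by rewrite eq_sym.
have [q0n q0n'] : q0 p != 0 /\ q0 p' != 0 by rewrite /q0; lia.
apply: (runs_call (@accum_spec R k _ (q1 p') (q1 p) _ _ _ _ _ _ _ _)) => //;
  try by rewrite /q1; lia.
move=> s1 sm1 r1; rewrite r6 in r1.
have {}r1 q i : i < K -> q != 0 -> trow s1 q i =
    if q == q1 p then (trow s (q1 p) i + rreg s 5 * trow s (q1 p') i)%R
    else trow s q i.
  by move=> iK qn0; rewrite r1 // convol_geo0.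
do 2 step.
have r11 : ireg s1 11 + ireg s1 4 = q0 p' * K by fr; rewrite s11 s4 base_q0.
have r13 : ireg s1 28 + ireg s1 5 = q0 p * K by fr; rewrite s28 s5 addn0.
rewrite r11 r13.
apply: (runs_last (@accum_spec R k _ (q0 p') (q0 p) _ _ _ _ _ _ _ _));
  try by fr; rewrite /q0; lia.
  by move=> i a iK aK; fr; apply: bin.
move=> s2 sm2 r2 q i iK qn0; rewrite r2 // /trow; fr; rewrite r6.
have -> : convol (fun a => rarr s1 2 (q0 p' * K + a)) (fun j => rreg s 5 * 0 ^+ j)%R i =
    (rreg s 5 * trow s1 (q0 p') i)%R by apply: convol_geo0.
rewrite -!/(trow s _ _) -!/(trow s1 _ _) !r1 //.
have -> : (q0 p' == q1 p) = false by rewrite /q0 /q1; lia.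
rewrite (negbTE q01); case: (q =P q0 p) => [->|_]; first by rewrite (negbTE q01).
by case: (q =P q1 p) => [->|].
Qed.

Lemma pc_or_child n ch j : onth pc n = Some (Or ch) -> j < size ch ->
  [/\ (nth (0, 0%R) ch j).1 \in map fst ch,
      or_child pc (field1 pc n + j) = (nth (0, 0%R) ch j).1
    & or_param pc (field1 pc n + j) = (nth (0, 0%R) ch j).2].
Proof.
move=> gn jch; rewrite /or_child /or_param /field1 gn (or_slice gn jch).
by split=> //; apply: map_f; apply: mem_nth.
Qed.

Lemma pc_or_spec n m s ch : pre n m s -> onth pc n = Some (Or ch) ->
  runs pc_or_case s (200 * K * K * (1 + size ch)) (post n m s).
Proof.
move=> pr gn; have [wfr _ _ _] := RC; have [wfp smp _ _ _] := PC.
have en := p_env pr; have nV := p_n pr; have mV := p_m pr.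
set p := pid n m.
have KK : 0 < K * K by [].
have KKs : size ch <= size ch * (K * K) by rewrite leq_pmulr.
have q10 : q1 p != q0 p by rewrite /q1 /q0; lia.
have q01 : q0 p != q1 p by rewrite eq_sym.
have [q1n q0n] : q1 p != 0 /\ q0 p != 0 by rewrite /q1 /q0; lia.
have q1le : q1 p <= q0 p by rewrite /q1 /q0; lia.
pose I j s' := [/\ 0 < j -> flag s' (q1 p) = sub n m,
   sub n m -> forall i, i < K ->
     trow s' (q1 p) i = (\sum_(e <- take j ch) e.2 * W true e.1 m i)%R /\
     trow s' (q0 p) i = (\sum_(e <- take j ch) e.2 * W false e.1 m i)%R
   & keeps p s s'].
rewrite /pc_or_case.
apply: (runs_forc (n := size ch) (t := 130 * K * K + 12) (I := I)).
- by rewrite (p25 pr) /field2 gn.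
- exact: e3 en.
- by [].
- split=> // _ i iK; rewrite /trow stE take0 !big_nil.
  by rewrite -!/(trow s _ i) !(p_0 pr).
- move=> j s' jn sm jj [I1 I2 [I3 I4]]; rewrite /pc_or_input.
  have [ech ec ep] := pc_or_child gn jn; set e := nth (0, 0%R) ch j in ech ec ep.
  have el := child_lt wfp gn ech.
  have elV : e.1 < Vp by lia.
  do 9 step.
  have r30 : ireg s' 24 + ireg s' 29 = field1 pc n + j by fr; rewrite jj (p24 pr).
  have i3 : iarr s' 3 (field1 pc n + j) = e.1 by fr; rewrite (eia en).
  have i8 : iarr s' 8 e.1 = q1 (e.1 * Vr) * K by fr; rewrite (p_row pr) //; lia.
  have r11 : q1 (e.1 * Vr) * K + ireg s' 9 = q1 (pid e.1 m) * K.
    by fr; rewrite (p9 pr) base_q1.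
  have i0 : rarr s' 0 (field1 pc n + j) = e.2 by fr; rewrite (era en).
  have r10 : ireg s' 10 = q1 p * K by fr; rewrite (p10 pr).
  have r5 : ireg s' 5 = 0 by fr; rewrite (e5 en).
  rewrite !(r30, i3, i8, r11, i0, r10, r5) addn0.
  have pep : pid e.1 m < p by apply: pid_lt_l.
  have [gS gT] := p_good pr elV mV pep.
  have subE : sub e.1 m = sub n m by rewrite /sub (scope_or wfp smp gn ech).
  have qe : [&& q1 (pid e.1 m) != q1 p, q1 (pid e.1 m) != q0 p,
      q0 (pid e.1 m) != q1 p, q0 (pid e.1 m) != q0 p, q1 (pid e.1 m) != 0
      & q0 (pid e.1 m) != 0] by rewrite /q0 /q1; lia.
  case/and5P: qe => q11 q10' q01' q00 /andP[q1n' q0n'].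
  apply: (runs_last (@accum_pair_spec _ (pid e.1 m) p _ _ _ _ _ _ _ _ _)) => //.
  all: try by fr; rewrite ?(e3 en) ?(e4 en) ?(p28 pr).
  + by move=> i a iK aK; fr; apply: (ebin en).
  + by budget.
  move=> s2 sm2 r2.
  have {}r2 q i : i < K -> q != 0 -> trow s2 q i =
      if q == q1 p then (trow s' q i + e.2 * trow s' (q1 (pid e.1 m)) i)%R
      else if q == q0 p then (trow s' q i + e.2 * trow s' (q0 (pid e.1 m)) i)%R
      else trow s' q i.
    by move=> iK qn0; rewrite r2 // /trow; fr.
  split; last split.
  + by move=> _; rewrite /flag; fr; rewrite eqxx -/(flag s' _) I4 // gS subE.
  + move=> sb i iK; rewrite -subE in sb; rewrite /trow; fr.
    rewrite -!/(trow s2 _ _) !r2 // !eqxx (negbTE q01).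
    rewrite subE in sb; have [-> ->] := I2 sb i iK.
    rewrite !I3 ?inE ?negb_or ?q11 ?q10' ?q01' ?q00 ?q1n' ?q0n' //.
    rewrite (take_nth (0, 0%R) jn) -/e !big_rcons /=.
    by rewrite -subE in sb; have [-> ->] := gT sb i iK.
  + move=> q i iK qn; have := qn; rewrite !inE !negb_or => /and3P[qn0 qn1 qn2].
    rewrite /trow; fr; rewrite -/(trow s2 _ _) r2 // (negbTE qn1) (negbTE qn2).
    by rewrite I3.
  by move=> q q1'; rewrite /flag; fr; rewrite eqn_pmul2r // (negbTE q1') -/(flag s' q) I4.
- by lia.
move=> s' _ [I1 I2 I3]; split=> //; split.
  by apply: I1; have := or_inputs_neq0 wfp gn; case: (ch).
move=> sb i iK; have [-> ->] := I2 sb i iK; rewrite take_size.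
by rewrite !(W_pc_or rc PC _ _ _ gn).
Qed.

Lemma copy_spec r s p' p :
  ireg s 3 = 1 -> ireg s 4 = K -> ireg s 5 = 0 -> ireg s r = q1 p' * K ->
  ireg s 10 = q1 p * K -> ireg s 28 = q0 p * K -> p' < p -> binok k s ->
  (forall q i, i < K -> q1 p <= q -> trow s q i = 0%R) ->
  runs (copy r) s (130 * K * K) (fun s' =>
    (forall q, flag s' q = if q == q1 p then 1 else flag s q) /\
    forall q i, i < K -> q != 0 -> trow s' q i =
      if q == q1 p then trow s (q1 p') i
      else if q == q0 p then trow s (q0 p') i else trow s q i).
Proof.
move=> s3 s4 s5 sr s10 s28 pp bin z.
have KK : 0 < K * K by [].
rewrite /copy; do 5 step; rewrite sr s10 s5 !addn0 s3.
apply: (runs_last (@accum_pair_spec _ p' p _ _ _ _ _ _ _ _ _)) => //.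
- by budget.
move=> s1 sm1 r1; split=> [q|q i iK qn0].
  by rewrite /flag; fr; rewrite eqn_pmul2r.
rewrite r1 // /trow; fr; rewrite -!/(trow s _ _).
case: (q =P q1 p) => [->|_]; first by rewrite z // add0r mul1r.
by case: (q =P q0 p) => [->|//]; rewrite z ?add0r ?mul1r // /q1 /q0; lia.
Qed.

Lemma skip_runs s T Q : 0 < T -> Q (set_ireg s 41 0) -> runs skip s T Q.
Proof. by move=> T0 q; apply: runs_instr1. Qed.

Lemma conv_pair_spec s p1 p2 p :
  ireg s 3 = 1 -> ireg s 4 = K -> ireg s 5 = 0 -> ireg s 11 = q1 p1 * K ->
  ireg s 12 = q1 p2 * K -> ireg s 13 = q1 p * K -> ireg s 28 = q0 p * K ->
  p1 < p -> p2 < p -> binok k s ->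
  runs conv_pair s (90 * K * K) (fun s' => forall q i, i < K ->
    trow s' q i =
      if q == q1 p then (trow s q i + convol (trow s (q1 p1)) (trow s (q1 p2)) i)%R
      else if q == q0 p then (trow s q i + convol (trow s (q0 p1)) (trow s (q0 p2)) i)%R
      else trow s q i).
Proof.
move=> s3 s4 s5 s11 s12 s13 s28 p1p p2p bin.
have KK : 0 < K * K by [].
have ne q : q < p -> [/\ q1 q != q1 p, q0 q != q1 p & q0 q != q0 p].
  by rewrite /q1 /q0; split; lia.
have [u1 u01 u0] := ne _ p1p; have [v1 v01 v0] := ne _ p2p.
apply: (runs_call (@conv_spec R k _ (q1 p1) (q1 p2) (q1 p) _ _ _ _ _ _ _ _)) => //.
  by budget.
move=> s1 sm1 r1; do 3 step.
have r11 : ireg s1 11 + ireg s1 4 = q0 p1 * K by fr; rewrite s11 s4 base_q0.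
have r12 : ireg s1 12 + ireg s1 4 = q0 p2 * K by fr; rewrite s12 s4 base_q0.
have r13 : ireg s1 28 + ireg s1 5 = q0 p * K by fr; rewrite s28 s5 addn0.
rewrite r11 r12 r13.
apply: (runs_last (@conv_spec R k _ (q0 p1) (q0 p2) (q0 p) _ _ _ _ _ _ _ _)) => //.
all: try by fr.
- by move=> i a iK aK; fr; apply: bin.
- by budget.
move=> s2 sm2 r2 q i iK; rewrite r2 //.
have tr q' j : q' != q1 p -> j < K -> rarr s1 2 (q' * K + j) = trow s q' j.
  by move=> q'1 jK; rewrite -/(trow s1 q' j) r1 // (negbTE q'1).
have q01 : q0 p != q1 p by rewrite /q1 /q0; lia.
case: (q =P q0 p) => [->|_]; last first.
  by rewrite /trow; fr; rewrite -/(trow s1 q i) r1 //; case: (q =P q1 p) => [->|].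
rewrite (negbTE q01) {1}/trow; fr; rewrite tr //; congr (_ + _)%R.
by apply: convol_eq => a ai; rewrite {1}/trow; fr; rewrite tr // (leq_ltn_trans ai iK).
Qed.

(** [s1] stands for [s] after the loads of [pc_and_case]. *)
Lemma and_and_spec n m s s1 T l r ml mr : pre n m s ->
  onth pc n = Some (And l r) -> onth rc m = Some (And ml mr) ->
  ~~ sub l m -> ~~ sub r m ->
  [/\ ireg s1 3 = ireg s 3, ireg s1 4 = ireg s 4 & ireg s1 5 = ireg s 5] ->
  [/\ ireg s1 10 = ireg s 10, ireg s1 28 = ireg s 28,
      ireg s1 26 = ireg s 26 & ireg s1 27 = ireg s 27] ->
  ireg s1 33 = q1 (l * Vr) * K -> ireg s1 34 = q1 (r * Vr) * K ->
  iarr s1 = iarr s -> rarr s1 = rarr s -> 110 * K * K <= T ->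
  runs and_and_case s1 T (post n m s).
Proof.
move=> pr gn gm nl nr [i3 i4 i5] [i10 i28 i26 i27] i33 i34 ia ra TT.
have en := p_env pr; have nV := p_n pr; have mV := p_m pr.
have [ln rn] := pc_and_lt PC gn; have [mlm mrm] := rc_and_lt RC gm.
have [lV rV] := (ltn_trans ln nV, ltn_trans rn nV).
have [mlV mrV] := (ltn_trans mlm mV, ltn_trans mrm mV).
set p := pid n m.
have pl : pid l ml < p by apply: pid_lt_l.
have pr' : pid r mr < p by apply: pid_lt_l.
have [g1S g1T] := p_good pr lV mlV pl.
have [g2S g2T] := p_good pr rV mrV pr'.
have subE : sub n m = sub l ml && sub r mr by apply: (scope_and_and wft PC RC gn gm nl nr).
have KK : 0 < K * K by [].
rewrite /and_and_case; do 10 step.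
rewrite i26 i27 i33 i34 i10 i3 i5 ia (p26 pr) (p27 pr) /field1 /field2 gm.
rewrite !(ecol en) // !base_q1 -!/(flag s _) g1S g2S (p10 pr) (e5 en) (e3 en) addn0.
have -> : sub l ml + sub r mr - 1 = sub n m by rewrite subE; case: (sub l ml); case: (sub r mr).
have trE q i : rarr s1 2 (q * K + i) = trow s q i by rewrite ra.
apply: (runs_last (@conv_pair_spec _ (pid l ml) (pid r mr) p _ _ _ _ _ _ _ _ _ _)) => //.
all: try by fr; rewrite ?i3 ?i4 ?i5 ?i28 ?(e3 en) ?(e4 en) ?(e5 en) ?(p28 pr).
- by move=> i a iK aK; fr; rewrite ra; apply: (ebin en).
- by budget.
move=> s2 sm2 r2.
have q01 : q0 p != q1 p by rewrite /q1 /q0; lia.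
have q1le : q1 p <= q0 p by rewrite /q1 /q0; lia.
have {}r2 q i : i < K -> trow s2 q i =
    if q == q1 p then convol (trow s (q1 (pid l ml))) (trow s (q1 (pid r mr))) i
    else if q == q0 p then convol (trow s (q0 (pid l ml))) (trow s (q0 (pid r mr))) i
    else trow s q i.
  move=> iK; rewrite r2 // {1 4 7}/trow; fr; rewrite !trE.
  case: (q =P q1 p) => [->|_].
    rewrite (p_0 pr) // add0r; apply: convol_eq => a ai; rewrite {1}/trow; fr; exact: trE.
  case: (q =P q0 p) => [->|//].
  rewrite (p_0 pr) // add0r; apply: convol_eq => a ai; rewrite {1}/trow; fr; exact: trE.
split; last split.
- split; first by rewrite /flag; fr; rewrite eqxx.
  rewrite subE => /andP[sl sr] i iK; rewrite !r2 // !eqxx (negbTE q01).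
  rewrite !(W_and_and wft PC RC _ _ gn gm) //.
  split; apply: convol_eq => a ai; have aK := leq_ltn_trans ai iK.
  + by case: (g1T sl a aK).
  + by case: (g2T sr a aK).
  + by case: (g1T sl a aK).
  + by case: (g2T sr a aK).
- move=> q i iK; rewrite !inE !negb_or => /and3P[qn0 qn1 qn2].
  by rewrite r2 // (negbTE qn2) (negbTE qn1).
by move=> q qn1; rewrite /flag; fr; rewrite eqn_pmul2r // (negbTE qn1) ia.
Qed.

Lemma pc_and_spec n m s l r : pre n m s -> onth pc n = Some (And l r) ->
  (forall ch, onth rc m <> Some (Or ch)) ->
  runs pc_and_case s (200 * K * K) (post n m s).
Proof.
move=> pr gn nor; have [wfr _ _ _] := RC; have [wfp _ _ _ _] := PC.
have en := p_env pr; have nV := p_n pr; have mV := p_m pr.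
have [ln rn] := pc_and_lt PC gn.
have [lV rV] : l < Vp /\ r < Vp by lia.
set p := pid n m.
have KK : 0 < K * K by [].
have q10 : q1 p != q0 p by rewrite /q1 /q0; lia.
have q01 : q0 p != q1 p by rewrite eq_sym.
have [q1n q0n] : q1 p != 0 /\ q0 p != 0 by rewrite /q1 /q0; lia.
have pl m' : m' < Vr -> pid l m' < p by apply: pid_lt_l.
have pr' m' : m' < Vr -> pid r m' < p by apply: pid_lt_l.
have [glS glT] := p_good pr lV mV (pl _ mV).
have [grS grT] := p_good pr rV mV (pr' _ mV).
have sub_n : sub n m = (scope rc m \subset scope pc l :|: scope pc r).
  by rewrite /sub (scopeE wfp gn).
have rl : iarr s 8 l = q1 (l * Vr) * K by rewrite (p_row pr) // ltnW.
have rr : iarr s 8 r = q1 (r * Vr) * K by rewrite (p_row pr) // ltnW.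
rewrite /pc_and_case; do 6 step.
rewrite (p24 pr) (p25 pr) (p9 pr) /field1 /field2 gn rl rr !base_q1.
rewrite -!/(flag s _) glS grS.
(* Shared by the two branches: [c] is the branch on which [m] depends, and register [x] holds the
   start of its rows. *)
have cp x c s1 T : c < n -> sub c m ->
    [/\ ireg s1 3 = ireg s 3, ireg s1 4 = ireg s 4, ireg s1 5 = ireg s 5,
       ireg s1 10 = ireg s 10 & ireg s1 28 = ireg s 28] ->
    rarr s1 3 = rarr s 3 -> (forall q i, trow s1 q i = trow s q i) ->
    (forall q, flag s1 q = flag s q) ->
    ireg s1 x = q1 (pid c m) * K -> 140 * K * K <= T ->
    (forall fl i, W fl n m i = W fl c m i) -> sub n m ->
    runs (copy x) s1 T (post n m s).
  move=> cn sc [i3 i4 i5 i10 i28] bs trs Ss sx_ TT WW sn.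
  have cV : c < Vp by lia.
  have pc_p : pid c m < p by apply: pid_lt_l.
  have [_ gT] := p_good pr cV mV pc_p.
  have qe : [&& q1 (pid c m) != q1 p, q1 (pid c m) != q0 p,
      q0 (pid c m) != q1 p, q0 (pid c m) != q0 p, q1 (pid c m) != 0
      & q0 (pid c m) != 0] by rewrite /q0 /q1; lia.
  apply: (runs_last (@copy_spec x _ (pid c m) p _ _ _ _ _ _ _ _ _)) => //.
  - by rewrite i3 (e3 en).
  - by rewrite i4 (e4 en).
  - by rewrite i5 (e5 en).
  - by rewrite i10 (p10 pr).
  - by rewrite i28 (p28 pr).
  - by move=> i a iK aK; rewrite bs (ebin en).
  - by move=> q i iK qq; rewrite trs (p_0 pr).
  - by budget.
  move=> s2 sm2 [S2 r2]; split; last split.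
  - split=> [|_ i iK]; first by rewrite S2 eqxx sn.
    rewrite !r2 // !eqxx (negbTE q01) !trs !WW.
    by case: (gT sc i iK).
  - move=> q i iK; rewrite !inE !negb_or => /and3P[qn0 qn1 qn2].
    by rewrite r2 // (negbTE qn1) (negbTE qn2) trs.
  by move=> q qn1; rewrite S2 (negbTE qn1) Ss.
apply: runs_if; rewrite ?stE /= ?(e5 en); first by budget.
  move=> sl; have {}sl : sub l m by case: (sub l m) sl.
  apply: (cp _ l) => //; try by fr.
  - by budget.
  - by move=> fl i; apply: (W_and_left wft PC RC _ _ gn mV sl).
  by rewrite sub_n; apply: subset_trans sl (subsetUl _ _).
move=> nl; have {}nl : ~~ sub l m by case: (sub l m) nl.
apply: runs_if; rewrite ?stE /= ?(e5 en); first by budget.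
  move=> sr; have {}sr : sub r m by case: (sub r m) sr.
  apply: (cp _ r) => //; try by fr.
  - by budget.
  - by move=> fl i; apply: (W_and_right wft PC RC _ _ gn mV sr).
  by rewrite sub_n; apply: subset_trans sr (subsetUr _ _).
move=> nr; have {}nr : ~~ sub r m by case: (sub r m) nr.
apply: runs_if; rewrite ?stE /= ?(e5 en); first by budget.
  rewrite (p23 pr) /gate_tag.
  have [g gm] := gate_at mV; rewrite gm; case: g gm => [v b|ml mr|ch] gm // _;
    last by case: (nor _ gm).
  by apply: (and_and_spec pr gn gm nl nr) => //; try fr; budget.
rewrite (p23 pr) /gate_tag.
have [g gm] := gate_at mV; rewrite gm; case: g gm => [v b|ml mr|ch] gm // _.
apply: skip_runs; first by budget.
have sn : sub n m = false.
  by rewrite /sub (scope_and_lit PC RC gn gm) -!/(sub _ _) (negbTE nl) (negbTE nr).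
split; last split.
- split; last by rewrite sn.
  by rewrite /flag; fr; rewrite -/(flag s _) (p_S0 pr) sn.
- by move=> q i iK _; rewrite /trow; fr.
by move=> q _; rewrite /flag; fr.
Qed.

Lemma pc_lit_spec n m s v b : pre n m s -> onth pc n = Some (Lit v b) ->
  (forall ch, onth rc m <> Some (Or ch)) ->
  runs pc_lit_case s (20 * K * K) (post n m s).
Proof.
move=> pr gn nor; have en := p_env pr; have nV := p_n pr; have mV := p_m pr.
set p := pid n m.
have KK : 0 < K * K by [].
have q10 : q1 p != q0 p by rewrite /q1 /q0; lia.
have q01 : q0 p != q1 p by rewrite eq_sym.
have nothing T : 0 < T -> sub n m = false -> runs skip s T (post n m s).
  move=> T0 sn; apply: skip_runs => //.
  split; last by split=> [q i iK _|q _]; rewrite /trow /flag; fr.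
  split; last by rewrite sn.
  by rewrite /flag; fr; rewrite -/(flag s _) (p_S0 pr) sn.
have [g gm] := gate_at mV; case: g gm => [v' b'|ml mr|ch] gm; last by case: (nor _ gm).
  rewrite /pc_lit_case.
  apply: runs_if; rewrite ?(e5 en) ?(p23 pr) /gate_tag ?gm //.
  move=> _.
  have subE : sub n m = (v' == v) by apply: (scope_lit_lit PC RC gn gm).
  apply: runs_if; rewrite ?(p24 pr) ?(p26 pr) /field1 ?gm ?gn; first by budget.
    by move=> ne; apply: nothing; [budget|rewrite subE; apply/eqP => E; rewrite E ltnn in ne].
  move=> le1; apply: runs_if; rewrite ?(p24 pr) ?(p26 pr) /field1 ?gm ?gn; first by budget.
    by move=> ne; apply: nothing; [budget|rewrite subE; apply/eqP => E; rewrite E ltnn in ne].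
  move=> le2; have vv : v' = v by apply/val_inj/eqP; rewrite eqn_leq le1.
  rewrite {}vv {le1 le2} in gm subE *; rewrite eqxx in subE.
  do 3 step; rewrite (p10 pr) (p28 pr) (e3 en) -[q0 _ * K]addn0.
  set s1 := set_rarr _ _ _ _.
  have S1 q : flag s1 q = if q == q1 p then 1 else flag s q.
    by rewrite /flag /s1; fr; rewrite eqn_pmul2r.
  have row1 q i : i < K -> trow s1 q i = if (q == q0 p) && (i == 0) then 1%R else trow s q i.
    by move=> iK; rewrite /s1 trow_set // /trow; fr.
  (* Covers both outcomes of the comparison of signs, which only affects entry 0 of the row with
     indicator. *)
  have fin1 s2 : (forall q, flag s2 q = flag s1 q) -> (forall q i, i < K -> trow s2 q i =
      if (q == q1 p) && (i == 0) then ((b == b')%:R)%R else trow s1 q i) -> post n m s s2.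
    move=> S2 row2; split; last split.
    - split=> [|_ i iK]; first by rewrite S2 S1 eqxx subE.
      rewrite (W_lit_true PC RC _ gn gm) (W_lit_false wft PC RC _ nV gm).
      rewrite !row2 // !row1 // !eqxx (negbTE q01) (negbTE q10) /= !(p_0 pr) //; last first.
        by rewrite /q0 /q1; lia.
      by case: i iK => [|i]; rewrite ?andbT ?andbF.
    - move=> q i iK; rewrite !inE !negb_or => /and3P[qn0 qn1 qn2].
      by rewrite row2 // (negbTE qn1) row1 // (negbTE qn2).
    by move=> q qn1; rewrite S2 S1 (negbTE qn1).
  have r25 : ireg s1 25 = b by rewrite /s1; fr; rewrite (p25 pr) /field2 gn.
  have r27 : ireg s1 27 = b' by rewrite /s1; fr; rewrite (p27 pr) /field2 gm.
  have r10 : ireg s1 10 = q1 p * K + 0 by rewrite /s1; fr; rewrite (p10 pr) addn0.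
  have r2 : rreg s1 2 = 1%R by rewrite /s1; fr.
  clearbody s1.
  have diff T : 0 < T -> b != b' -> runs skip s1 T (post n m s).
    move=> T0 /negbTE bb; apply: skip_runs => //; apply: fin1 => [q|q i iK].
      by rewrite /flag; fr.
    have -> : trow (set_ireg s1 41 0) q i = trow s1 q i by rewrite /trow; fr.
    rewrite bb row1 //.
    case: (q =P q1 p) => [->|//]; rewrite (negbTE q10) (p_0 pr) //.
    by case: ifP.
  apply: runs_if; first by budget.
    by rewrite r25 r27 => ne; apply: diff; [budget|move: (b) (b') ne => [] []].
  rewrite r25 r27 => le1; apply: runs_if; first by budget.
    by rewrite r25 r27 => ne; apply: diff; [budget|move: (b) (b') ne => [] []].
  rewrite r25 r27 => le2; have bb : b = b' by move: (b) (b') le1 le2 => [] [].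
  fin; rewrite r10 r2; apply: fin1 => [q|q i iK].
    by rewrite /flag; fr.
  by rewrite trow_set // bb eqxx.
rewrite /pc_lit_case.
apply: runs_if; rewrite ?(e5 en) ?(p23 pr) /gate_tag ?gm //.
by move=> _; apply: nothing; [budget|apply: (scope_lit_and wft PC RC gn gm)].
Qed.

Lemma pair_spec n m s : pre n m s ->
  runs pair_case s (250 * K * K * (1 + deg pc n + deg rc m)) (post n m s).
Proof.
move=> pr; have en := p_env pr; have nV := p_n pr; have mV := p_m pr.
have KK : 0 < K * K by [].
(* [50 * K * K] covers the tests selecting the case; [c] is the degree of the OR gate treated, and 0
   in the other cases. *)
have TT c : c <= deg pc n + deg rc m ->
    50 * K * K + 200 * K * K * (1 + c) <= 250 * K * K * (1 + deg pc n + deg rc m).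
  by rewrite -[1 + _ + _]addnA -![_ * K * K]mulnA; move: (deg _ _ + deg _ _) (K * K) => D A le; nia.
have T0 := TT _ (leq0n _).
have [gp gn] := gate_at nV; have [gr gm] := gate_at mV.
have tagn : gate_tag pc n = if gp is And _ _ then 1 else if gp is Or _ then 2 else 0.
  by rewrite /gate_tag gn; case: gp {gn}.
have tagm : gate_tag rc m = if gr is And _ _ then 1 else if gr is Or _ then 2 else 0.
  by rewrite /gate_tag gm; case: gr {gm}.
rewrite /pair_case; apply: runs_if; first by budget.
  rewrite (e3 en) (p23 pr) tagm; case: gr gm {tagm} => // ch gm _.
  have Tc : size ch <= deg pc n + deg rc m.
    by rewrite /deg gm /= size_map leq_addl.
  apply: (runs_last (rc_or_spec pr gm)) => //.
  by have := TT _ Tc; budget.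
rewrite (e3 en) (p23 pr) tagm => nor'; have nor ch : onth rc m <> Some (Or ch).
  by move=> E; move: nor'; move: gm; rewrite E => -[<-].
apply: runs_if; first by budget.
  rewrite (e3 en) (p22 pr) tagn; case: gp gn {tagn} => // ch gn _.
  have Tc : size ch <= deg pc n + deg rc m.
    by rewrite /deg gn /= size_map leq_addr.
  apply: (runs_last (pc_or_spec pr gn)) => //.
  by have := TT _ Tc; budget.
rewrite (e3 en) (p22 pr) tagn => norn; apply: runs_if; first by budget.
  rewrite (e5 en) (p22 pr) tagn; case: gp gn norn {tagn} => // l r gn _ _.
  apply: (runs_last (pc_and_spec pr gn nor)) => //.
  by budget.
rewrite (e5 en) (p22 pr) tagn; case: gp gn norn {tagn} => // v b gn _ _.
apply: (runs_last (pc_lit_spec pr gn nor)) => //.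
by budget.
Qed.

(** * Auxiliary tables and the loops over pairs *)

Lemma binom_table_spec s : ireg s 0 = k -> ireg s 3 = 1 -> ireg s 4 = K ->
  ireg s 5 = 0 -> (forall q, rarr s 3 q = 0%R) ->
  runs binom_table s (40 * K * K) (binok k).
Proof.
move=> s0 s3 s4 s5 z.
have KK : K <= K * K by rewrite leq_pmulr.
rewrite /binom_table; do 3 step.
pose I i s' := ireg s' 17 = i * K /\
  forall i' a, i' <= i -> a < K -> rarr s' 3 (i' * K + a) = ('C(i', a)%:R)%R.
apply: (runs_forc (n := k) (t := 20 * K) (I := I)); rewrite ?stE //=; last 2 first.
- by lia.
- by move=> s' _ [_ rows] i a iK aK; apply: rows.
- split=> [|i a]; first by fr.
  by rewrite leqn0 => /eqP -> aK; fr; rewrite mul0n add0n z bin0n; case: (a).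
move=> i s' ik sm ii [rb rows]; rewrite /binom_row; do 3 step.
pose J a s2 := (forall i' b, i' <= i -> b < K -> rarr s2 3 (i' * K + b) = ('C(i', b)%:R)%R) /\
  forall b, b <= a -> rarr s2 3 (i.+1 * K + b) = ('C(i.+1, b)%:R)%R.
have r18 : ireg s' 17 + ireg s' 4 = i.+1 * K by fr; rewrite rb s4; lia.
rewrite r18; apply: (@runs_call _ _ _ _ (14 * K) _ (J k)); [|budget|].
  apply: (runs_forc (n := k) (t := 10) (I := J)) => //.
  - by fr.
  - by fr.
  - split=> [i' b i'i bK|b]; fr.
      rewrite -[i.+1 * K]addn0 trow_eq // (_ : i' == i.+1 = false) ?rows //; lia.
    by rewrite leqn0 => /eqP ->; rewrite addn0 eqxx bin0.
  - move=> a s2 ak sm2 aa [J1 J2]; rewrite /binom_entry; do 7 step; fin.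
    have r17 : ireg s2 17 + ireg s2 15 = i * K + a by fr; rewrite rb aa.
    have r18' : ireg s2 18 + ireg s2 15 = i.+1 * K + a by fr; rewrite aa.
    have r3 : ireg s2 3 = 1 by fr.
    rewrite r17 r18' r3 -!addnA !addn1 !J1 //; last by lia.
    split=> [i' b i'i bK|b]; fr.
      rewrite trow_eq // (_ : i' == i.+1 = false) ?J1 //; lia.
    rewrite eqn_add2l leq_eqVlt ltnS => /predU1P[->|ba].
      by rewrite eqxx binS addrC natrD.
    by rewrite (_ : b == a.+1 = false) ?J2 //; lia.
  - by budget.
move=> s2 sm2 [J1 J2]; fin; split=> [|i' a]; fr; first by rewrite s5 addn0.
rewrite leq_eqVlt => /predU1P[->|i'i] aK; first by rewrite J2.
by rewrite J1.
Qed.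

Lemma col_table_spec s : ireg s 2 = Vr -> ireg s 3 = 1 -> ireg s 20 = 2 * K ->
  runs col_table s (3 + 4 * Vr)
    (fun s' => forall m, m < Vr -> iarr s' 9 m = m * (2 * K)).
Proof.
move=> s2 s3 s20; rewrite /col_table; step.
pose I m s' := ireg s' 21 = m * (2 * K) /\
  forall m', m' < m -> iarr s' 9 m' = m' * (2 * K).
apply: (runs_forc (n := Vr) (t := 2) (I := I)); rewrite ?stE //=; last 2 first.
- by lia.
- by move=> s' _ [_ H].
move=> m s' mV sm mm [r21 cols]; step; fin; split=> [|m']; fr.
  by rewrite r21 s20; lia.
rewrite ltnS leq_eqVlt mm r21 => /predU1P[->|lt]; first by rewrite eqxx.
by rewrite (ltn_eqF lt) cols.
Qed.

Record inv N s : Prop := Inv {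
  i_good : forall n m, n < Vp -> m < Vr -> pid n m < N -> good s n m;
  i_0 : forall q i, i < K -> q1 N <= q -> trow s q i = 0%R;
  i_S0 : forall q, q1 N <= q -> flag s q = 0 }.

Lemma inv_eq N s s' : rarr s' = rarr s -> iarr s' 10 = iarr s 10 -> inv N s -> inv N s'.
Proof.
move=> ra ia [g z zS].
have tE q i : trow s' q i = trow s q i by rewrite /trow ra.
have sE q : flag s' q = flag s q by rewrite /flag ia.
split=> [n m nV mV lt|q i iK qq|q qq]; rewrite ?tE ?sE ?z ?zS //.
have [gS gT] := g _ _ nV mV lt; split; first by rewrite sE.
by move=> sb i iK; rewrite !tE; apply: gT.
Qed.

Lemma pid_inj n m n' m' : m < Vr -> m' < Vr -> pid n m = pid n' m' -> n = n' /\ m = m'.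
Proof.
move=> mV m'V E; have V0 : 0 < Vr by lia.
have := congr1 (divn^~ Vr) E; have := congr1 (modn^~ Vr) E.
by rewrite /pid !modnMDl !divnMDl // !modn_small // !divn_small // !addn0.
Qed.

Lemma inv_step n m s s' : n < Vp -> m < Vr -> inv (pid n m) s -> post n m s s' ->
  inv (pid n m).+1 s'.
Proof.
move=> nV mV [g z zS] [gnm [kT kS]]; split.
- move=> n' m' n'V m'V; rewrite ltnS leq_eqVlt => /predU1P[/(pid_inj m'V mV)[-> ->] //|lt].
  have [gS gT] := g _ _ n'V m'V lt; split; first by rewrite kS // /q1; lia.
  move=> sb i iK; have := gT sb i iK.
  by rewrite !kT //; rewrite !inE /q1 /q0; lia.
- move=> q i iK qq; rewrite kT //; first by rewrite z //; move: qq; rewrite /q1; lia.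
  by rewrite !inE; move: qq; rewrite /q1 /q0; lia.
by move=> q qq; rewrite kS; [rewrite zS //|]; move: qq; rewrite /q1; lia.
Qed.

Lemma pair_step_spec n m s : env s -> n < Vp -> m < Vr ->
  ireg s 6 = n -> ireg s 7 = m -> ireg s 10 = q1 (pid n m) * K ->
  (forall n', n' <= n -> iarr s 8 n' = q1 (n' * Vr) * K) -> inv (pid n m) s ->
  runs pair_step s (10 + 250 * K * K * (1 + deg pc n + deg rc m)) (fun s' =>
    ireg s' 10 = q1 (pid n m).+1 * K /\ inv (pid n m).+1 s').
Proof.
move=> en nV mV s6 s7 s10 rows iv; rewrite /pair_step /pair_load; do 9 step.
set s1 := set_ireg _ 28 _.
have iv1 : inv (pid n m) s1 by apply: inv_eq iv; rewrite /s1; fr.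
have pr : pre n m s1.
  split=> //; rewrite ?s6 ?s7.
  - split; rewrite /s1; fr; by case: en.
  - by rewrite /s1; fr; rewrite s10 (e4 en) base_q0.
  - by rewrite /s1; fr; rewrite s6 rows.
  - by rewrite /s1; fr; rewrite s7 (ecol en).
  - by rewrite /s1; fr; rewrite s6 (eia en).
  - by rewrite /s1; fr; rewrite s7 (eia en).
  - by rewrite /s1; fr; rewrite s6 (eia en).
  - by rewrite /s1; fr; rewrite s6 (eia en).
  - by rewrite /s1; fr; rewrite s7 (eia en).
  - by rewrite /s1; fr; rewrite s7 (eia en).
  - exact: i_good iv1.
  - exact: i_0 iv1.
  - by apply: (i_S0 iv1).
have r10 : ireg s1 10 = q1 (pid n m) * K by rewrite /s1; fr.
have r20 : ireg s1 20 = 2 * K by rewrite /s1; fr; apply: (e20 en).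
clearbody s1.
apply: (runs_call (pair_spec pr)); first by budget.
move=> s2 sm2 po; fin; split.
  by fr; rewrite r10 r20 /q1; lia.
by apply: inv_eq (inv_step nV mV iv1 po); fr.
Qed.

Lemma pair_row_spec n s : env s -> n < Vp -> ireg s 6 = n ->
  ireg s 10 = q1 (n * Vr) * K ->
  (forall n', n' < n -> iarr s 8 n' = q1 (n' * Vr) * K) -> inv (n * Vr) s ->
  runs pair_row s (3 + 270 * K * K * (Vr * (1 + deg pc n) + num_edges rc)) (fun s' =>
    [/\ ireg s' 10 = q1 (n.+1 * Vr) * K, inv (n.+1 * Vr) s' &
        forall n', n' < n.+1 -> iarr s' 8 n' = q1 (n' * Vr) * K]).
Proof.
move=> en nV s6 s10 rows iv; rewrite /pair_row; step.
set s1 := set_iarr _ _ _ _.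
have sm1 : same (Instr (IStore 8 6 10)) s s1 := exec_same (ExecInstr _ s).
have en1 : env s1 by apply: env_same sm1 en.
have iv1 : inv (n * Vr) s1 by apply: inv_eq iv; rewrite /s1; fr.
have rows1 n' : n' < n.+1 -> iarr s1 8 n' = q1 (n' * Vr) * K.
  rewrite /s1; fr; rewrite s6 s10 ltnS leq_eqVlt => /predU1P[->|lt].
    by rewrite eqxx.
  by rewrite (ltn_eqF lt) rows.
have r6 : ireg s1 6 = n by rewrite /s1; fr.
have r10 : ireg s1 10 = q1 (pid n 0) * K by rewrite /s1 /pid addn0; fr.
clearbody s1; clear sm1.
pose I m s' := ireg s' 10 = q1 (pid n m) * K /\ inv (pid n m) s'.
apply: (runs_for (n := Vr) (I := I)
    (tb := fun m => 10 + 250 * K * K * (1 + deg pc n + deg rc m))).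
- exact: e2 en1.
- exact: e3 en1.
- by [].
- split; first by fr.
  by rewrite /pid addn0; apply: inv_eq iv1; fr.
- move=> m s2 mV sm2 mm [s2_10 iv2].
  apply: (runs_last (pair_step_spec _ nV mV _ mm s2_10 _ iv2)) => //.
  + by apply: env_same sm2 en1.
  + by fr.
  + by move=> n' n'n; fr; apply: rows1.
  move=> s3 sm3 [s3_10 iv3]; split; fr; first by rewrite s3_10 /pid addnS.
  by rewrite {1}/pid addnS; apply: inv_eq iv3; fr.
(* For a fixed [n], the degrees of the RC gates add up to the number of edges of the RC. *)
- rewrite (_ : \sum_(m < Vr) _ =
      Vr * (12 + 250 * (K * K) * (1 + deg pc n)) + 250 * (K * K) * num_edges rc); last first.
    rewrite (eq_bigr (fun m : 'I_Vr => (12 + 250 * (K * K) * (1 + deg pc n)) +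
      250 * (K * K) * deg rc m)) => [|m _]; last by lia.
    by rewrite big_split /= sum_nat_const card_ord -big_distrr /= deg_sum.
  have VV : Vr * (K * K) >= Vr by rewrite leq_pmulr.
  by rewrite -![_ * K * K]mulnA; move: VV; move: (K * K) (deg pc n) (num_edges rc) => A D E; nia.
move=> s2 sm2 [s2_10 iv2]; have E : pid n Vr = n.+1 * Vr by rewrite /pid mulSn addnC.
split; rewrite -?E // => n' n'n; fr; apply: rows1 n'n.
Qed.

Lemma moment_program_spec : 0 < k ->
  exists (T : nat) (s : state R),
    [/\ exec moment_program (input k pc rc) T s,
        T <= 400 * K * K * (Vp * Vr + Vp * num_edges rc + Vr * num_edges pc + Vp + Vr)
      & output s = moment k (rc_out rc) (pc_dist pc)].
Proof.
move=> k0; have [wfr _ _ _] := RC; have [wfp _ _ _ full] := PC.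
have V0 : 0 < Vp by case: wfp; case: (pc).
have V0' : 0 < Vr by case: wfr; case: (rc).
have KK : K <= K * K by rewrite leq_pmulr.
set T := 400 * _ * _ * _.
suff [t0 [s [e le o]]] : runs moment_program (input k pc rc) T
    (fun s => output s = moment k (rc_out rc) (pc_dist pc)) by exists t0, s.
set s0 := input k pc rc.
have i0 : ireg s0 0 = k by [].
have i1 : ireg s0 1 = Vp by [].
have i2 : ireg s0 2 = Vr by [].
have i5 : ireg s0 5 = 0 by [].
have z A q : 2 <= A -> rarr s0 A q = 0%R by case: A => [|[|[]]] //= A; rewrite nth_nil.
have zi A q : 8 <= A -> iarr s0 A q = 0.
  by move=> A8; rewrite [iarr _ _]nth_default.
pose L := 2 + \sum_(n < Vp)
  (2 + (3 + 270 * K * K * (Vr * (1 + deg pc n) + num_edges rc))).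
have hT : 3 + 40 * K * K + (3 + 4 * Vr) + 1 + L + 2 <= T.
  rewrite /L /T (eq_bigr (fun n : 'I_Vp => (5 + 270 * (K * K) * (Vr + num_edges rc)) +
      270 * (K * K) * Vr * deg pc n)) => [|n _]; last by lia.
  rewrite big_split /= sum_nat_const card_ord -big_distrr /= deg_sum.
  have : 0 < K * K by [].
  rewrite -![_ * K * K]mulnA; move: (K * K) (num_edges pc) (num_edges rc) => A sp sr A0.
  have VA : Vp + Vr <= (Vp + Vr) * A by rewrite leq_pmulr.
  have VV : A <= Vp * Vr * A by rewrite leq_pmull // muln_gt0 V0.
  have nn : 0 <= A * (Vr * sp) by [].
  have nn' : 0 <= A * (Vp * sr) by [].
  by nia.
have sE0 A : rarr s0 A = rarr (input k pc rc) A by [].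
have aE0 A : iarr s0 A = iarr (input k pc rc) A by [].
have LE : 2 + \sum_(n < Vp)
  (2 + (3 + 270 * K * K * (Vr * (1 + deg pc n) + num_edges rc))) <= L by [].
clearbody s0 T L; rewrite /moment_program; do 3 step.
rewrite i0 -[k + 1]/(k + 1) addn1.
apply: (runs_call (@binom_table_spec _ _ _ _ _ _)); try by fr.
  by move=> q; fr; rewrite z.
  by budget.
move=> s1 sm1 bin1.
apply: (runs_call (@col_table_spec _ _ _ _)); try by fr; rewrite ?i2 // mul2n addnn.
  by budget.
move=> s2 sm2 cols; step.
set s3 := set_ireg s2 10 _.
have en : env s3.
  split; rewrite /s3; fr => //; try by rewrite ?i1 ?i2 // addnn mul2n.
  - by case=> [|[|[|[|[|[|[|[]]]]]]]] //= _; fr; rewrite aE0.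
  - by case=> [|[]] //= _; fr; rewrite sE0.
  - by move=> i a iK aK; fr; apply: bin1.
have s3_10 : ireg s3 10 = q1 (0 * Vr) * K by rewrite /s3; fr; rewrite i5 addn0 mul1n.
have tE : rarr s3 2 = rarr s0 2 by rewrite /s3; fr.
have iE : iarr s3 10 = iarr s0 10 by rewrite /s3; fr.
have inv0 : inv 0 s3.
  by split=> // [q i iK _|q _]; rewrite /trow /flag ?tE ?iE ?z ?zi.
clearbody s3; clear sm1 sm2.
pose I n s := [/\ ireg s 10 = q1 (n * Vr) * K, inv (n * Vr) s &
        forall n', n' < n -> iarr s 8 n' = q1 (n' * Vr) * K].
apply: (@runs_call _ _ _ _ L _ (I Vp)); [|by budget|].
  apply: (runs_for (n := Vp) (I := I)
    (tb := fun n => 3 + 270 * K * K * (Vr * (1 + deg pc n) + num_edges rc))) => //.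
  - exact: e1 en.
  - exact: e3 en.
  - by split=> //; apply: inv_eq inv0; fr.
  - move=> n s nV sm nn [s10 iv rows].
    apply: (runs_last (pair_row_spec _ nV nn s10 rows iv)) => //.
      exact: env_same sm en.
    move=> s' sm' [s'10 iv' rows']; split; fr => //.
    by apply: inv_eq iv'; fr.
move=> s4 sm4 [s4_10 iv _]; step; fin.
set p := pid (root_node pc) (root_node rc).
have pE : Vp * Vr = p.+1.
  by rewrite /p /pid /root_node; case: Vp V0 => // a _; case: Vr V0' => // b _ /=; rewrite mulSn; lia.
(* Register 10 now points just past the rows of the root pair; one entry before lies the moment of
   order [k] without indicator. *)
have r18 : ireg s4 10 - ireg s3 3 = q0 p * K + k.
  by rewrite s4_10 (e3 en) pE /q1 /q0; lia.
rewrite /output; fr; rewrite r18 -/(trow s4 _ _) (moment_W rc PC).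
have [_ gT] : good s4 (root_node pc) (root_node rc).
  by apply: (i_good iv); rewrite ?prednK ?pE.
by case: (gT _ k (ltnSn k)) => //; rewrite /sub full subsetT.
Qed.

End Pairs.

Theorem theorem1 :
  exists (P : cmd) (C : nat),
    forall (R : realFieldType) (d : nat) (t : vtree d) (pc rc : circuit d R)
           (k : nat),
      wf_vtree t -> is_PC t pc -> is_RC t rc -> (1 <= k)%N ->
      exists (T : nat) (s : state R),
        [/\ exec P (input k pc rc) T s,
            (T <= C * (k ^ 2 * maxn 1 (num_edges pc) * maxn 1 (num_edges rc)))%N
          & output s = moment k (rc_out rc) (pc_dist pc)].
Proof.
(* The factor 48 is 4 * 12. For [k >= 1] the square of [k.+1] is at most 4 times that of [k]. A size
   is at most twice [maxn 1] of the number of edges, so the five terms of the bound are at most 4,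
   2, 2, 2 and 2 times the product of these maxima, which also cover circuits without edges. *)
exists moment_program, (400 * 48) => R d t pc rc k wft PC RC k0.
have [T [s [e le o]]] := moment_program_spec wft PC RC k0.
exists T, s; split=> //; apply: leq_trans le _.
have [[wfp _ _ _ _] [wfr _ _ _]] := (PC, RC).
have := size_circuit wfp; have := size_circuit wfr.
move: (size pc) (size rc) (num_edges pc) (num_edges rc) => a b x y bY aX.
set X := maxn 1 x; set Y := maxn 1 y.
have [xX yY X0 Y0] : [/\ x <= X, y <= Y, 0 < X & 0 < Y] by rewrite /X /Y; split; lia.
have [aX' bY'] : a <= 2 * X /\ b <= 2 * Y by rewrite /X /Y; lia.
clearbody X Y.
have KK : k.+1 * k.+1 <= 4 * (k * k) by nia.
have : a * b + a * y + b * x + a + b <= 12 * (X * Y).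
  have := leq_mul aX' bY'; have := leq_mul aX' yY; have := leq_mul bY' xX.
  have := leq_mul aX' Y0; have := leq_mul bY' X0; lia.
rewrite -mulnn -!mulnA leq_mul2l /= => le.
rewrite mulnA; apply: leq_trans (leq_mul KK le) _.
by rewrite (_ : 4 * (k * k) * (12 * (X * Y)) = 48 * (k * (k * (X * Y)))) //; ring.
Qed.
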